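(* Let $((A,H,D),P)$ be a quadruple of Toeplitz type associated to a unital C*-algebra $\mathcal A$ such that $L_{\mathcal A}$ is a Lip-norm. (1) For any $a\in A_{\mathcal A}$ and $k\in A_{\mathcal C}$, $$L_{1,\beta}(T(a)+k)\to L_{1,0}(T(a)+k)=L_{\mathcal A}(a)\quad\text{for }\beta\to0.$$ (2) For states $\phi,\psi$ on $\mathcal T$ with decompositions $\phi=\iota_{\mathcal C}(f)+\iota_{\mathcal A}(\mu)$, $\psi=\iota_{\mathcal C}(g)+\iota_{\mathcal A}(\nu)$, the quantity $\mathrm{dist}_{1,0}(\phi,\psi):=\sup\{|\phi(t)-\psi(t)|: t\in A_{\mathcal T},\ L_{1,0}(t)\le1\}$ satisfies $$\mathrm{dist}_{1,0}(\phi,\psi)=\begin{cases}0&\text{if }\phi=\psi,\\ \infty&\text{if }f\ne g,\\ \|\mu\|\,\mathrm{dist}_{\mathcal A}\big(\mu/\|\mu\|,\nu/\|\mu\|\big)&\text{if }f=g\text{ and }\mu\ne\nu.\end{cases}$$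
   Context: Spectral triple: for a unital C*-algebra $\mathcal A\subseteq B(H)$ (containing $I_H$), a spectral triple $(A,H,D)$ associated to $\mathcal A$ consists of the Hilbert space $H$, a dense self-adjoint subalgebra $A\subseteq\mathcal A$, and an unbounded self-adjoint operator $D$ on $H$ such that $[D,a]$ is bounded and densely defined for all $a\in A$ and $(I+D^2)^{-1}$ is compact. It is assumed that $I\in A$. Norms of bounded densely defined commutators are norms of their bounded closures. $C(PH)$ denotes the compact operators on $PH$. Toeplitz type: let $P$ be an orthogonal projection in $B(H)$. The quadruple $((A,H,D),P)$ is of Toeplitz type if: (i) $P$ commutes with $D$ (i.e. with all spectral projections of $D$); (ii) $Pa-aP$ is compact for all $a\in\mathcal A$; (iii) the homomorphism $\varphi:\mathcal A\to B(PH)/C(PH)$, $\varphi(a)=Pa|_{PH}+C(PH)$, is faithful; (iv) for every $a\in A$ the commutators $[PD,a]$ and $[(I-P)D,a]$ are bounded and densely defined, and their common domain of definition contains the two subspaces $\mathrm{dom}([D,a])\cap PH$ and $\mathrm{dom}([D,a])\cap(I-P)H$, which are dense in $PH$ and $(I-P)H$ respectively; (v) $D_p:=D|_{PH}$ has trivial kernel. Put $D_q:=D|_{(I-P)H}$. Associated objects: $\kappa:B(PH)\to B(PH)/C(PH)$ is the quotient map; $\mathcal T$ is the C*-algebra on $PH$ generated by $\{Pa|_{PH}: a\in\mathcal A\}\cup C(PH)$ (one has $\kappa(\mathcal T)=\varphi(\mathcal A)$); $\rho:\mathcal T\to \mathcal A\subseteq B(H)$, $\rho(t)=\varphi^{-1}(\kappa(t))$;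 $T(a)=Pa|_{PH}$; $A_c=\{k\in C(PH): D_pk \text{ and } kD_p \text{ are bounded}\}$; $A_t=\{T(a)+k: a\in A, k\in A_c\}$; $K=PH\oplus H=PH\oplus PH\oplus (I-P)H$; $\pi(t)=t\oplus\rho(t)$ on $PH\oplus H$; for $\alpha>0$, $\beta\geq 0$, with respect to $K=PH\oplus PH\oplus(I-P)H$, $$D_{\alpha,\beta}=\begin{pmatrix}0&\beta D_p&0\\ \beta D_p&\frac1\alpha D_p&0\\0&0&\frac1\alpha D_q\end{pmatrix}.$$ Seminorms: $A_{\mathcal A}=\{a\in A:a=a^*\}$ with $L_{\mathcal A}(a)=\|[D,a]\|$; $A_{\mathcal C}=\{k+\lambda I:\lambda\in\mathbb R,\ k=k^*\in A_c\}$; $A_{\mathcal T}=\{t\in A_t:t=t^*\}$ with $L_{\alpha,\beta}(t)=\|[D_{\alpha,\beta},\pi(t)]\|$, including the case $(\alpha,\beta)=(1,0)$. $\mathrm{dist}_{\mathcal A}(\mu,\nu)=\sup\{|\mu(a)-\nu(a)|:a\in A_{\mathcal A},L_{\mathcal A}(a)\le1\}$ for states $\mu,\nu$ of $\mathcal A$. ''$L_{\mathcal A}$ is a Lip-norm'' means: $L_{\mathcal A}(a)=0$ iff $a\in\mathbb RI$, and $\mathrm{dist}_{\mathcal A}$ induces the weak*-topology on the state space $S(\mathcal A)$. Decomposition of states: for $f\in C(PH)^*$, $\iota_{\mathcal C}(f)\in\mathcal T^*$ is the restriction to $\mathcal T$ of the canonical (normal) extension of $f$ to $B(PH)=C(PH)^{**}$;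 for $\mu\in\mathcal A^*$, $\iota_{\mathcal A}(\mu)=\mu\circ\rho\in\mathcal T^*$. Every state $\phi$ of $\mathcal T$ can be written uniquely as $\phi=\iota_{\mathcal C}(f)+\iota_{\mathcal A}(\mu)$ with $f$, $\mu$ positive functionals on $C(PH)$, $\mathcal A$, and $\|f\|+\|\mu\|=1$. *)

(* Defs.v *)
From HB Require Import structures.
From mathcomp Require Import all_boot all_order all_algebra sesquilinear.
From mathcomp Require Import complex.
From mathcomp Require Import all_classical all_reals all_analysis.

Set Implicit Arguments.
Unset Strict Implicit.
Unset Printing Implicit Defensive.

Import Order.TTheory GRing.Theory Num.Theory numFieldNormedType.Exports.

Local Open Scope classical_set_scope.
Local Open Scope complex_scope.
Local Open Scope ring_scope.

(* Inner products are linear in the first and conjugate-linear in the second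
   argument. *)
HB.mixin Record NormedModule_hasDot (R : realType) H & NormedModule R[i] H := {
  hdot : {dot H for (@Num.conj R[i])} ;
  hdotE : forall x : H, `|x| ^+ 2 = hdot x x
}.

#[short(type="innerType")]
HB.structure Definition Inner (R : realType) :=
  {H of NormedModule R[i] H & NormedModule_hasDot R H}.

#[short(type="hilbertType")]
HB.structure Definition Hilbert (R : realType) :=
  {H of Inner R H & Complete H}.

Section dot_norm.
Context {C : numClosedFieldType} {V : lmodType C}.
Variable f : {dot V for (@Num.conj C)}.

Lemma dot_CauchySchwarz u v : `|f u v| ^+ 2 <= f u u * f v v.
Proof.
have [->|v0] := eqVneq v 0; first by rewrite !linear0r normr0 expr0n.
have fv : 0 < f v v by rewrite dnorm_gt0.
pose a := f u v / f v v.
have := dnorm_ge0 f (u - a *: v).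
have fvr : (f v v)^* = f v v by rewrite geC0_conj// ltW.
have -> : f (u - a *: v) (u - a *: v) = f u u - `|f u v| ^+ 2 / f v v.
  rewrite dnormB dnormZ linearZr_LR /=.
  have -> : `|a| ^+ 2 * f v v = `|f u v| ^+ 2 / f v v.
    rewrite normrM normfV (gtr0_norm fv) exprMn exprVn -mulrA expr2 invfM.
    by rewrite mulfVK// gt_eqF.
  have -> : a^* * f u v = `|f u v| ^+ 2 / f v v.
    by rewrite rmorphM/= fmorphV/= fvr mulrAC [_^* * _]mulrC -normCK.
  have -> : (`|f u v| ^+ 2 / f v v)^* = `|f u v| ^+ 2 / f v v.
    by rewrite geC0_conj// divr_ge0// ?exprn_ge0// ltW.
  by rewrite opprD addrA addrK.
by rewrite subr_ge0 ler_pdivrMr.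
Qed.

Lemma dot_ler_normD u v :
  sqrtC (f (u + v) (u + v)) <= sqrtC (f u u) + sqrtC (f v v).
Proof.
rewrite -ler_sqr ?nnegrE ?addr_ge0 ?sqrtC_ge0 ?dnorm_ge0//.
rewrite sqrrD !sqrtCK dnormD [leRHS]addrAC lerD2l.
have -> : f u v + (f u v)^* = 'Re (f u v) *+ 2.
  by rewrite ReE -mulr_natr divfK ?pnatr_eq0.
rewrite lerMn2r/=.
apply: le_trans (leif_Re_Creal _) _.
rewrite -ler_sqr ?nnegrE ?mulr_ge0 ?sqrtC_ge0 ?dnorm_ge0//.
by rewrite exprMn !sqrtCK dot_CauchySchwarz.
Qed.

Lemma dot_normrZ (a : C) u :
  sqrtC (f (a *: u) (a *: u)) = `|a| * sqrtC (f u u).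
Proof.
by rewrite dnormZ sqrtCM ?nnegrE ?exprn_ge0 ?dnorm_ge0// sqrCK.
Qed.

Lemma dot_normr0_eq0 u : sqrtC (f u u) = 0 -> u = 0.
Proof. by move/eqP; rewrite sqrt_dnorm_eq0 => /eqP. Qed.

End dot_norm.

HB.factory Record Lmodule_hasDot (R : realType) H & GRing.Lmodule R[i] H := {
  dot : {dot H for (@Num.conj R[i])}
}.

HB.builders Context R H & Lmodule_hasDot R H.

HB.instance Definition _ := Lmodule_isNormed.Build R[i] H
  (dot_ler_normD dot) (dot_normrZ dot) (@dot_normr0_eq0 _ _ dot).

Let dotE (x : H) : `|x| ^+ 2 = dot x x.
Proof. exact: sqrtCK. Qed.

HB.instance Definition _ := NormedModule_hasDot.Build R H dotE.

HB.end.


Section hilbert_theory.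
Context {R : realType} {H : innerType R}.

Lemma norm_sqrt_hdot (x : H) : `|x| = sqrtC (hdot x x).
Proof. by rewrite -hdotE sqrCK. Qed.

End hilbert_theory.

Record orthoproj (R : realType) (H : innerType R) := OrthoProj {
  oproj :> {linear H -> H} ;
  oproj_idem : forall x, oproj (oproj x) = oproj x ;
  oproj_sym : forall x y, hdot (oproj x) y = hdot x (oproj y)
}.

Section orthoproj_theory.
Context {R : realType} {H : innerType R} (P : orthoproj H).

Lemma oproj_norm_le x : `|P x| <= `|x|.
Proof.
have E : hdot (x - P x) (P x) = 0.
  by rewrite -oproj_sym linearB/= oproj_idem subrr linear0l.
rewrite -ler_sqr ?nnegrE// !hdotE -[in leRHS](subrK (P x) x).
by rewrite dnormD E rmorph0 !addr0 lerDr dnorm_ge0.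
Qed.

Definition oproj_compl_fun (x : H) : H := x - P x.

Lemma oproj_compl_linear : linear oproj_compl_fun.
Proof.
move=> a x y; rewrite /oproj_compl_fun linearP scalerBr opprD.
by rewrite !addrA; congr (_ + _); rewrite addrAC.
Qed.
HB.instance Definition _ := GRing.isLinear.Build R[i] H H *:%R
  oproj_compl_fun oproj_compl_linear.

Lemma oproj_compl_idem x :
  oproj_compl_fun (oproj_compl_fun x) = oproj_compl_fun x.
Proof. by rewrite /oproj_compl_fun linearB/= oproj_idem subrr subr0. Qed.

Lemma oproj_compl_sym x y :
  hdot (oproj_compl_fun x) y = hdot x (oproj_compl_fun y).
Proof. by rewrite linearBl linearBr/= oproj_sym. Qed.

Definition oproj_compl := OrthoProj oproj_compl_idem oproj_compl_sym.

Definition in_rng : {pred H} := fun x => P x == x.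

Lemma in_rng_submod_closed : submod_closed in_rng.
Proof.
split=> [|a x y]; rewrite !unfold_in; first by rewrite linear0.
by move=> /eqP Px /eqP Py; rewrite linearP Px Py.
Qed.
HB.instance Definition _ := GRing.isSubmodClosed.Build R[i] H in_rng
  in_rng_submod_closed.

Record rng := Rng { rng_val :> H ; rng_valP : rng_val \in in_rng }.

HB.instance Definition _ := [isSub for rng_val].
HB.instance Definition _ := [Choice of rng by <:].
HB.instance Definition _ := [SubChoice_isSubLmodule of rng by <:].

Definition rng_dot (x y : rng) : R[i] := hdot (rng_val x) (rng_val y).

Lemma rng_val_linear : linear rng_val. Proof. by []. Qed.

Lemma rng_valB x y : rng_val (x - y) = rng_val x - rng_val y.
Proof. by []. Qed.

Lemma rng_dot_bilinear : bilinear_for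
  (GRing.Scale.Law.clone _ _ *%R _)
  (GRing.Scale.Law.clone _ _ (Num.conj \; *%R) _) rng_dot.
Proof.
split=> [v|u] a x y; rewrite /rng_dot rng_val_linear.
- by rewrite linearPl.
- by rewrite linearPr.
Qed.
HB.instance Definition _ := bilinear_isBilinear.Build R[i] rng rng R[i] _ _
  rng_dot rng_dot_bilinear.

Lemma rng_dot_herm x y :
  rng_dot x y = (-1) ^+ false * Num.conj (rng_dot y x).
Proof. exact: hermC. Qed.
HB.instance Definition _ := isHermitianSesquilinear.Build R[i] rng
  false Num.conj rng_dot rng_dot_herm.

Lemma rng_dot_gt0 x : x != 0 -> 0 < rng_dot x x.
Proof. by move=> x0; apply: neq0_dnorm_gt0. Qed.
HB.instance Definition _ := isDotProduct.Build R[i] rng rng_dot rng_dot_gt0.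

HB.instance Definition _ := Lmodule_hasDot.Build R rng rng_dot.

Lemma rng_norm (x : rng) : `|x| = `|rng_val x|.
Proof. by rewrite !norm_sqrt_hdot. Qed.

Lemma prj_subproof x : P x \in in_rng.
Proof. by rewrite unfold_in oproj_idem. Qed.

(* P with codomain restricted to PH. *)
Definition prj (x : H) : rng := Rng (prj_subproof x).

Lemma rng_valK (x : rng) : P (rng_val x) = rng_val x.
Proof. by case: x => x /= /eqP. Qed.

End orthoproj_theory.

Section rng_complete.
Context {R : realType} {H : hilbertType R} (P : orthoproj H).

Lemma rng_complete (F : set_system (rng P)) :
  ProperFilter F -> cauchy F -> cvg F.
Proof.
move=> FF /cauchyP Fc.
pose G := @rng_val _ _ P @ F.
have Gc : cauchy G.
  apply/cauchy_exP => e e0; have [x Fx] := Fc e e0.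
  exists (rng_val x); apply: (@filterS _ F _ (ball x e)) Fx => z.
  by rewrite /= -!ball_normE /= rng_norm rng_valB.
have /cvg_ex[x Gx] : cvg G by apply: cauchy_cvg.
apply/cvg_ex; exists (prj P x); apply/cvgrPdist_le => e e0.
move/cvgrPdist_le : Gx => /(_ _ e0); apply: filterS => z /=.
rewrite rng_norm; apply: le_trans; rewrite rng_valB/= -[in leLHS](rng_valK z) -linearB.
exact: oproj_norm_le.
Qed.
HB.instance Definition _ := Uniform_isComplete.Build (rng P) rng_complete.
End rng_complete.

(* Hilbert-space direct sum; an alias of the product, whose own norm in the
   library is the maximum norm. *)
Definition hsum (V W : Type) : Type := (V * W)%type.

Section hsum.
Context {R : realType} (V W : innerType R).

HB.instance Definition _ := GRing.Lmodule.copy (hsum V W) (V * W)%type.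

Definition hsum_dot (x y : hsum V W) : R[i] := hdot x.1 y.1 + hdot x.2 y.2.

Lemma hsum_dot_bilinear : bilinear_for
  (GRing.Scale.Law.clone _ _ *%R _)
  (GRing.Scale.Law.clone _ _ (Num.conj \; *%R) _) hsum_dot.
Proof.
split=> [v|u] a x y; rewrite /hsum_dot /=.
- by rewrite !linearPl mulrDr addrACA.
- by rewrite !linearPr /= mulrDr addrACA.
Qed.
HB.instance Definition _ := bilinear_isBilinear.Build R[i] (hsum V W) (hsum V W)
  R[i] _ _ hsum_dot hsum_dot_bilinear.

Lemma hsum_dot_herm x y :
  hsum_dot x y = (-1) ^+ false * Num.conj (hsum_dot y x).
Proof.
by rewrite /hsum_dot hermC [hdot x.2 _]hermC !expr0 !mul1r rmorphD.
Qed.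
HB.instance Definition _ := isHermitianSesquilinear.Build R[i] (hsum V W)
  false Num.conj hsum_dot hsum_dot_herm.

Lemma hsum_dot_gt0 x : x != 0 -> 0 < hsum_dot x x.
Proof.
move=> x0; rewrite lt_neqAle addr_ge0 ?dnorm_ge0// andbT eq_sym.
rewrite paddr_eq0 ?dnorm_ge0// !dnorm_eq0.
apply: contra x0 => /andP[/eqP x1 /eqP x2]; apply/eqP.
by case: x x1 x2 => x1 x2 /= -> ->.
Qed.
HB.instance Definition _ :=
  isDotProduct.Build R[i] (hsum V W) hsum_dot hsum_dot_gt0.

HB.instance Definition _ := Lmodule_hasDot.Build R (hsum V W) hsum_dot.

Lemma hsum_norm (x : hsum V W) : `|x| ^+ 2 = `|x.1| ^+ 2 + `|x.2| ^+ 2.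
Proof. by rewrite !hdotE. Qed.

Lemma hsum_norm1 (x : hsum V W) : `|x.1| <= `|x|.
Proof. by rewrite -ler_sqr ?nnegrE// hsum_norm lerDl exprn_ge0. Qed.

Lemma hsum_norm2 (x : hsum V W) : `|x.2| <= `|x|.
Proof. by rewrite -ler_sqr ?nnegrE// hsum_norm lerDr exprn_ge0. Qed.

Lemma hsum_norm_le (x : hsum V W) : `|x| <= `|x.1| + `|x.2|.
Proof.
rewrite -ler_sqr ?nnegrE ?addr_ge0// hsum_norm sqrrD addrAC lerDl.
by rewrite mulrn_wge0// mulr_ge0.
Qed.

End hsum.

Section hsum_complete.
Context {R : realType} (V W : hilbertType R).

Lemma hsum_complete (F : set_system (hsum V W)) :
  ProperFilter F -> cauchy F -> cvg F.
Proof.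
move=> FF /cauchyP Fc.
have Fc1 : cauchy ((@fst V W : hsum V W -> V) @ F).
  apply/cauchy_exP => e e0; have [x Fx] := Fc e e0.
  exists x.1; apply: (@filterS _ F _ (ball x e)) Fx => z.
  by rewrite /= -!ball_normE /=; apply: le_lt_trans; exact: (hsum_norm1 (x - z)).
have Fc2 : cauchy ((@snd V W : hsum V W -> W) @ F).
  apply/cauchy_exP => e e0; have [x Fx] := Fc e e0.
  exists x.2; apply: (@filterS _ F _ (ball x e)) Fx => z.
  by rewrite /= -!ball_normE /=; apply: le_lt_trans; exact: (hsum_norm2 (x - z)).
have /cvg_ex[x Fx] : cvg ((@fst V W : hsum V W -> V) @ F) by exact: cauchy_cvg.
have /cvg_ex[y Fy] : cvg ((@snd V W : hsum V W -> W) @ F) by exact: cauchy_cvg.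
apply/cvg_ex; exists ((x, y) : hsum V W); apply/cvgrPdist_le => e e0.
have e2 : 0 < e / 2 by rewrite divr_gt0.
move/cvgrPdist_le : Fx => /(_ _ e2) Fx; move/cvgrPdist_le : Fy => /(_ _ e2) Fy.
apply: filterS2 Fx Fy => z zx zy.
apply: (le_trans (hsum_norm_le _)); rewrite [leRHS]splitr.
exact: lerD.
Qed.
HB.instance Definition _ := Uniform_isComplete.Build (hsum V W) hsum_complete.

End hsum_complete.

Section operators.
Context {R : realType}.

(* The norms of the library take values in R[i]; this is the same real number
   as an element of R (for V := R[i] it is the modulus). *)
Definition nrm {V : normedZmodType R[i]} (x : V) : R := complex.Re `|x|.

Section defs.
Context {H : hilbertType R}.
Implicit Types (T a b : H -> H) (x y z : H).

(* Everywhere defined operators are plain functions H -> H; the vector space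
   operations on them are the pointwise ones, the product is \o. *)
Definition bounded_op : set (H -> H) :=
  [set T | linear T /\ exists M : R, forall x, nrm (T x) <= M * nrm x].

Definition compact_op : set (H -> H) :=
  [set T | linear T /\ precompact (T @` [set x | nrm x <= 1])].

Definition is_adjoint T (S : H -> H) := forall x y, hdot (T x) y = hdot x (S y).

(* Unbounded operators; only the values of ufun on udom are meaningful. *)
Record uop := UOp { udom : set H ; ufun : H -> H }.

Definition total T : uop := UOp setT T.
Definition ucomp (T S : uop) : uop :=
  UOp [set x | udom S x /\ udom T (ufun S x)] (ufun T \o ufun S).
Definition uadd (T S : uop) : uop :=
  UOp (udom T `&` udom S) (ufun T \+ ufun S).
Definition usub (T S : uop) : uop :=
  UOp (udom T `&` udom S) (ufun T \- ufun S).
Definition commutator (T : uop) a : uop :=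
  usub (ucomp T (total a)) (ucomp (total a) T).

Definition ulinear (T : uop) :=
  udom T 0 /\
  forall (c : R[i]) x y, udom T x -> udom T y ->
    udom T (c *: x + y) /\ ufun T (c *: x + y) = c *: ufun T x + ufun T y.

(* Densely defined, with graph equal to the graph of the adjoint. *)
Definition self_adjoint (T : uop) :=
  [/\ ulinear T, dense (udom T) &
      forall y z, (udom T y /\ ufun T y = z) <->
                  (forall x, udom T x -> hdot (ufun T x) y = hdot x z)].

Definition densely_bounded (T : uop) :=
  dense (udom T) /\
  exists M : R, forall x, udom T x -> nrm (ufun T x) <= M * nrm x.

(* For a densely defined bounded T this is the norm of its bounded closure. *)
Definition unorm (T : uop) : \bar R :=
  ereal_sup [set (nrm (ufun T x))%:E | x in [set x | udom T x /\ nrm x <= 1]].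

Definition opnorm T : \bar R := unorm (total T).

(* (I + D^2)^-1 exists as an everywhere defined compact operator. *)
Definition compact_resolvent (D : uop) :=
  let ID2 := uadd (total idfun) (ucomp D D) in
  exists K : H -> H,
    [/\ compact_op K,
        forall y, udom ID2 (K y) /\ ufun ID2 (K y) = y &
        forall x, udom ID2 x -> K (ufun ID2 x) = x].

(* E is the projection-valued spectral measure of D, that is,
   D = \int l dE(l), expressed through the measures <E(.)x, x>. *)
Definition spectral_measure (D : uop) (E : set R -> orthoproj H) :=
  [/\ forall x, E setT x = x,
      forall S1 S2 : set (measurableTypeR R), measurable S1 -> measurable S2 ->
        forall x, E (S1 `&` S2) x = E S1 (E S2 x) &
      forall x, exists m : {measure set (measurableTypeR R) -> \bar R},
        [/\ forall S : set (measurableTypeR R), measurable S ->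
              m S = (complex.Re (hdot (E S x) x))%:E,
            udom D x <-> (\int[m]_l (l ^+ 2)%:E < +oo)%E &
            udom D x -> hdot (ufun D x) x = (\int[m]_l l)%:C]].

(* P commutes with all spectral projections E(S) of D. For self-adjoint D the
   spectral theorem gives existence and uniqueness of E. *)
Definition commutes_with (P : orthoproj H) (D : uop) :=
  exists E : set R -> orthoproj H, spectral_measure D E /\
    forall S : set (measurableTypeR R), measurable S ->
      forall x, P (E S x) = E S (P x).

Record star_algebra (S : set (H -> H)) : Prop := {
  star_bounded : S `<=` bounded_op ;
  star0 : S (0 : H -> H) ;
  star_lin : forall (c : R[i]) a b, S a -> S b -> S (c *: a + b) ;
  star_mul : forall a b, S a -> S b -> S (a \o b) ;
  star_adj : forall a, S a -> exists2 b, S b & is_adjoint a b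
}.

Definition norm_closure (S : set (H -> H)) : set (H -> H) :=
  [set T | bounded_op T /\
    forall e : R, 0 < e -> exists2 a, S a & (opnorm (T - a)%R <= e%:E)%E].

Definition cstar_algebra (S : set (H -> H)) :=
  star_algebra S /\ norm_closure S `<=` S.

Definition unital_cstar_algebra (S : set (H -> H)) :=
  cstar_algebra S /\ S idfun.

(* The class of t in B(H)/C(H), as a coset. *)
Definition calkin (t : H -> H) : set (H -> H) :=
  [set s | bounded_op s /\ compact_op (s - t)].

(* Functionals on an operator space S are represented by functions on all of
   H -> H, whose values outside S are irrelevant. *)
Definition functional := (H -> H) -> R[i].
Implicit Types (S : set (H -> H)) (phi psi : functional).

Definition eq_on S phi psi := forall a, S a -> phi a = psi a.

Definition linear_on S phi := forall (c : R[i]) a b, S a -> S b ->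
  phi (c *: a + b) = c * phi a + phi b.

Definition positive_functional S phi := linear_on S phi /\
  forall a b, S a -> S b -> is_adjoint a b -> 0 <= phi (b \o a).

Definition state S phi := positive_functional S phi /\ phi idfun = 1.

Definition fnorm S phi : \bar R :=
  ereal_sup [set (nrm (phi a))%:E | a in
    [set a | S a /\ (opnorm a <= 1)%E]].

(* The (possibly infinite) distance of functionals defined by a seminorm L
   with domain S. *)
Definition seminorm_dist S (L : (H -> H) -> \bar R) phi psi : \bar R :=
  ereal_sup [set (nrm (phi a - psi a)%R)%:E | a in
    [set a | S a /\ (L a <= 1)%E]].

Definition weak_star_open S (U : set functional) :=
  forall phi, state S phi -> U phi ->
  exists (B : set (H -> H)) (e : R),
    [/\ finite_set B, B `<=` S, 0 < e &
        forall psi, state S psi ->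
          (forall a, B a -> nrm (psi a - phi a) < e) -> U psi].

Definition dist_open S (d : functional -> functional -> \bar R)
    (U : set functional) :=
  forall phi, state S phi -> U phi ->
  exists2 e : R, 0 < e &
    forall psi, state S psi -> (d phi psi < e%:E)%E -> U psi.

Definition induces_weak_star S (d : functional -> functional -> \bar R) :=
  forall U : set functional, dist_open S d U <-> weak_star_open S U.

(* Ultraweak (sigma-weak) continuity at 0 on B(H), for the seminorms
   T |-> |\sum_n <T x_n, y_n>| with x, y square-summable sequences. *)
Definition square_summable (x : nat -> H) :=
  (\sum_(0 <= n <oo) ((nrm (x n)) ^+ 2)%:E < +oo)%E.

Definition ultraweak_form (x y : nat -> H) T : R[i] :=
  limn ((fun N => \sum_(n < N) hdot (T (x n)) (y n)) : nat -> R[i]^o).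

Definition ultraweakly_continuous (F : functional) :=
  forall e : R, 0 < e ->
  exists (m : nat) (x y : 'I_m -> nat -> H) (d : R),
    [/\ forall i, square_summable (x i) /\ square_summable (y i), 0 < d &
        forall T, bounded_op T ->
          (forall i, nrm (ultraweak_form (x i) (y i) T) < d) ->
          nrm (F T) < e].

(* F is the canonical (normal) extension to B(H) of the functional f on C(H);
   it is unique on B(H). *)
Definition normal_extension (f F : functional) :=
  [/\ linear_on bounded_op F, eq_on compact_op F f & ultraweakly_continuous F].

End defs.

Arguments uop : clear implicits.
Arguments functional : clear implicits.

Record spectral_triple {H : hilbertType R} (cA A : set (H -> H)) (D : uop H)
    : Prop := {
  st_star : star_algebra A ;
  st_sub : A `<=` cA ;
  st_dense : cA `<=` norm_closure A ;
  st_unit : A idfun ;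
  st_self_adjoint : self_adjoint D ;
  st_bounded : forall a, A a -> densely_bounded (commutator D a) ;
  st_compact : compact_resolvent D
}.

Section toeplitz.
Context {H : hilbertType R}.
Variables (cA A : set (H -> H)) (D : uop H) (P : orthoproj H).

Local Notation PH := (rng P).
Local Notation QH := (rng (oproj_compl P)).

(* T(a), the compression of a to PH. *)
Definition toep (a : H -> H) : PH -> PH := prj P \o a \o rng_val (P:=P).

(* The restriction of D to the range of a projection commuting with it. *)
Definition restrict (Q : orthoproj H) : uop (rng Q) :=
  UOp [set x | udom D (rng_val x)] (prj Q \o ufun D \o rng_val (P:=Q)).

Local Notation Dp := (restrict P).
Local Notation Dq := (restrict (oproj_compl P)).

(* The operator product Q D, whose domain is that of D. *)
Definition compressed (Q : orthoproj H) : uop H := ucomp (total Q) D.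

Record toeplitz_type : Prop := {
  tt_triple : spectral_triple cA A D ;
  tt_commutes : commutes_with P D ;
  tt_compact : forall a, cA a -> compact_op (P \o a - a \o P : H -> H) ;
  tt_faithful : forall a b, cA a -> cA b ->
    calkin (toep a) = calkin (toep b) -> a = b ;
  tt_bounded : forall a, A a ->
    densely_bounded (commutator (compressed P) a) /\
    densely_bounded (commutator (compressed (oproj_compl P)) a) ;
  tt_domain : forall a, A a ->
    let common := udom (commutator (compressed P) a) `&`
                  udom (commutator (compressed (oproj_compl P)) a) in
    (forall x : PH, udom (commutator D a) (rng_val x) -> common (rng_val x)) /\
    (forall x : QH, udom (commutator D a) (rng_val x) -> common (rng_val x)) ;
  tt_dense : forall a, A a ->
    dense [set x : PH | udom (commutator D a) (rng_val x)] /\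
    dense [set x : QH | udom (commutator D a) (rng_val x)] ;
  tt_kernel : forall x : PH, udom Dp x -> ufun Dp x = 0 -> x = 0
}.

(* The C*-algebra generated by the T(a), a in cA, and C(PH). *)
Definition toeplitz_algebra : set (PH -> PH) :=
  smallest cstar_algebra ((toep @` cA) `|` compact_op).

(* rho(t) = phi^-1(kappa(t)), where phi(a) is the class of T(a); the default 0
   is not reached for t in the Toeplitz algebra. *)
Definition rho (t : PH -> PH) : H -> H :=
  xget 0 [set a | cA a /\ calkin (toep a) = calkin t].

(* "Bounded" includes "densely defined", as for commutators. *)
Definition smooth_compact : set (PH -> PH) :=
  [set k | [/\ compact_op k, densely_bounded (ucomp Dp (total k)) &
               densely_bounded (ucomp (total k) Dp)]].

Definition smooth_toeplitz : set (PH -> PH) :=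
  [set t | exists a k, [/\ A a, smooth_compact k & t = toep a + k]].

(* K = PH + H is written PH + PH + (I - P)H, h in H being the pair
   (P h, (I - P) h). *)
Definition Ksum : hilbertType R := hsum PH (hsum PH QH).

Definition pi_rep (t : PH -> PH) : Ksum -> Ksum := fun v =>
  let h := rho t (rng_val v.2.1 + rng_val v.2.2) in
  (t v.1, (prj P h, prj (oproj_compl P) h)).

(* The matrix operator has the domain dom(Dp) + dom(Dp) + dom(Dq) for all
   parameters, also for be = 0. *)
Definition Dab (al be : R) : uop Ksum :=
  @UOp Ksum [set v | [/\ udom Dp v.1, udom Dp v.2.1 & udom Dq v.2.2]]
      (fun v => (be%:C *: ufun Dp v.2.1,
                 (be%:C *: ufun Dp v.1 + (al^-1)%:C *: ufun Dp v.2.1,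
                  (al^-1)%:C *: ufun Dq v.2.2))).

Definition sa_A : set (H -> H) := [set a | A a /\ is_adjoint a a].
Definition L_A (a : H -> H) : \bar R := unorm (commutator D a).

Definition sa_C : set (PH -> PH) :=
  [set t | exists k (l : R), [/\ smooth_compact k, is_adjoint k k &
                                 t = k + l%:C *: (idfun : PH -> PH)]].

Definition sa_T : set (PH -> PH) :=
  [set t | smooth_toeplitz t /\ is_adjoint t t].
Definition L_T (al be : R) (t : PH -> PH) : \bar R :=
  unorm (commutator (Dab al be) (pi_rep t)).

Definition dist_A : functional H -> functional H -> \bar R :=
  seminorm_dist sa_A L_A.
Definition dist_T (al be : R) : functional PH -> functional PH -> \bar R :=
  seminorm_dist sa_T (L_T al be).

Definition lip_norm_A :=
  (forall a, sa_A a ->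
     (L_A a = 0%E <-> exists l : R, a = l%:C *: (idfun : H -> H))) /\
  induces_weak_star cA dist_A.

(* phi = iota_C(f) + iota_A(mu) on the Toeplitz algebra, with f and mu positive
   and ||f|| + ||mu|| = 1. *)
Record decomposition (phi f : functional PH) (mu : functional H) : Prop := {
  dec_f : positive_functional compact_op f ;
  dec_mu : positive_functional cA mu ;
  dec_norm : (fnorm compact_op f + fnorm cA mu = 1)%E ;
  dec_eq : exists F, normal_extension f F /\
    forall t, toeplitz_algebra t -> phi t = F t + mu (rho t)
}.

End toeplitz.
End operators.

Arguments toep {R H} P a.
Arguments decomposition {R H} cA P phi f mu.
Arguments sa_C {R H} D P _.
Arguments sa_T {R H} A D P _.
Arguments L_T {R H} cA D P al be t.
Arguments dist_T {R H} cA A D P al be _ _.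
Arguments toeplitz_algebra {R H} cA P _.
Arguments uop {R} H.
Arguments functional {R} H.

(* Main.v *)
Require Import Defs.
From HB Require Import structures.
From mathcomp Require Import all_boot all_order all_algebra sesquilinear.
From mathcomp Require Import complex ring lra.
From mathcomp Require Import all_classical all_reals all_analysis.
From mathcomp Require Import measurable_realfun.

Set Implicit Arguments.
Unset Strict Implicit.
Unset Printing Implicit Defensive.

Import Order.TTheory GRing.Theory Num.Theory numFieldNormedType.Exports.

Local Open Scope classical_set_scope.
Local Open Scope complex_scope.
Local Open Scope ring_scope.

(** Write [Q = I - P] and let [t = T(a) + k] with [a] in [A] and [k] compact, so
    that [rho(t) = a] by faithfulness. As [P] reduces [D] (lemma [reducing]),
    a vector of [K] can be read as a pair [(x, h)] with [x] in [PH] and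
    [h = y + z] in [H], on which [D_{1,b}] acts as
    [(x, h) |-> (b D P h, b D x + D h)] and [pi(t)] as [(t x, a h)]. Hence
    (lemma [commutator_Dab])

      [D_{1,b}, pi(t)] (x, h)
        = (b (D P a h - t D P h),  b (D t x - a D x) + [D, a] h).

    For [b = 0] only [[D, a] h] is left, which gives [L_{1,0}(t) = L_A(a)]
    ([L_T_at0]). Vectors with [x = 0] show [L_A(a) <= L_{1,b}(t)] for all [b]
    ([L_A_le_L_T]). If [a] and [k] are self-adjoint and [k] is smooth, both
    factors of [b] are bounded: the first is [P [PD, a] h - k D P h]. In the
    second [x] and [t x] are in the domain of [D], while [a x] need not be, so it
    is tested against [g] in the dense domain of [[D, a]], where it becomes
    [<x, k D P g> - <x, [PD, a] g>]. So [L_{1,b}(t) <= L_A(a) + b C]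
    ([L_T_upper]), and part (1) follows by squeezing.

    For part (2), [L_{1,0}] vanishes on the smooth compact operators. If
    [phi - psi] is nonzero on one of these, scaling it makes the distance
    infinite. The operators [<., u> u], with [u] in the dense domain of [D_p],
    are smooth and self-adjoint, and they determine [f] ([rank_one_diag_eq] and
    [ultraweak_eq_rank_one]): continuity and polarization give all rank one
    operators, and an ultraweakly continuous functional sees only finitely many
    vectors up to a small error, so that an operator may be compressed to a
    finite dimensional subspace containing them. Thus the distance is infinite
    when [f] and [g] differ.

    When [f = g], their normal extensions agree too, and
    [phi(t) - psi(t) = mu(a) - nu(a)]. As [t] ranges over the self-adjoint
    elements with [L_{1,0}(t) <= 1], [a = rho(t)] ranges over those with
    [L_A(a) <= 1]; that [a] is self-adjoint uses that adjoints of compact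
    operators are compact ([adjoint_compact], [symbol_selfadjoint]). It remains
    to factor out [|mu| = 1 - |f| = 1 - |g| = |nu|], which is positive since
    otherwise [mu = nu = 0]. *)

(** * The real-valued norm and density *)

Section real_norm.
Context {R : realType}.

Lemma nrmE {V : normedZmodType R[i]} (x : V) : (nrm x)%:C = `|x|.
Proof. by rewrite /nrm RRe_real // normr_real. Qed.

Section normed_zmodule.
Context {V : normedZmodType R[i]}.
Implicit Types x y z : V.

Lemma ler_nrm {W : normedZmodType R[i]} x (y : W) :
  (nrm x <= nrm y) = (`|x| <= `|y|).
Proof. by rewrite -lecR !nrmE. Qed.

Lemma nrm_ge0 x : 0 <= nrm x.
Proof. by have := normr_ge0 x; rewrite -nrmE lecR. Qed.

Lemma nrm0 : nrm (0 : V) = 0.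
Proof. by rewrite /nrm normr0. Qed.

Lemma nrm_eq0 x : (nrm x == 0) = (x == 0).
Proof. by rewrite -(inj_eq (@complexI R)) nrmE normr_eq0. Qed.

Lemma nrmN x : nrm (- x) = nrm x.
Proof. by rewrite /nrm normrN. Qed.

Lemma nrm_distC x y : nrm (x - y) = nrm (y - x).
Proof. by rewrite -nrmN opprB. Qed.

Lemma ler_nrmD x y : nrm (x + y) <= nrm x + nrm y.
Proof. by rewrite -lecR rmorphD/= !nrmE ler_normD. Qed.

Lemma ler_nrmB x y : nrm (x - y) <= nrm x + nrm y.
Proof. by rewrite -[in leRHS](nrmN y) ler_nrmD. Qed.

End normed_zmodule.

Lemma nrmZ {V : normedModType R[i]} (c : R[i]) (x : V) :
  nrm (c *: x) = nrm c * nrm x.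
Proof. by apply: (@complexI R); rewrite rmorphM/= !nrmE normrZ. Qed.

Lemma nrmM (c d : R[i]) : nrm (c * d) = nrm c * nrm d.
Proof. by apply: (@complexI R); rewrite rmorphM/= !nrmE normrM. Qed.

Lemma nrmV (c : R[i]) : nrm c^-1 = (nrm c)^-1.
Proof. by apply: (@complexI R); rewrite fmorphV/= !nrmE normfV. Qed.

Lemma nrm_real (r : R) : nrm (r%:C : R[i]) = `|r|.
Proof.
by apply: (@complexI R); rewrite nrmE normc_def/= expr0n/= addr0 sqrtr_sqr.
Qed.

Lemma nrm_sum {V : normedZmodType R[i]} (I : Type) (r : seq I) (Q : pred I)
    (F : I -> V) : nrm (\sum_(i <- r | Q i) F i) <= \sum_(i <- r | Q i) nrm (F i).
Proof.
elim/big_rec2 : _ => [|i x y _ xy]; first by rewrite nrm0.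
by rewrite (le_trans (ler_nrmD _ _))// lerD2l.
Qed.

Section normed_module.
Context {V : normedModType R[i]}.
Implicit Types x y z : V.

Lemma nbhs_nrm (x : V) (e : R) : 0 < e -> nbhs x [set y | nrm (x - y) < e].
Proof.
move=> e0; apply/nbhs_ballP; exists e%:C => /=; first by rewrite ltcR.
by move=> y; rewrite -ball_normE/= -nrmE ltcR.
Qed.

Lemma nbhs_nrmP (x : V) (U : set V) : nbhs x U ->
  exists2 e : R, 0 < e & forall y, nrm (x - y) < e -> U y.
Proof.
move=> /nbhs_ballP[e /= e0 eU].
have eE : e = (complex.Re e)%:C by rewrite RRe_real// gtr0_real.
exists (complex.Re e); first by rewrite -ltcR -eE.
by move=> y xy; apply: eU; rewrite -ball_normE/= -nrmE eE ltcR.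
Qed.

Lemma denseP (S : set V) :
  dense S <-> forall x (e : R), 0 < e -> exists2 y, S y & nrm (x - y) < e.
Proof.
split=> [dS x e e0|dS U [x Ux]].
  have eC : 0 < e%:C :> R[i] by rewrite ltcR.
  have [||y [+ Sy]] := dS (ball x e%:C); first by exists x; exact: ballxx.
    exact: ball_open.
  by rewrite -ball_normE/= -nrmE ltcR => xy; exists y.
move=> oU; have /nbhs_nrmP[e e0 eU] : nbhs x U by exact: open_nbhs_nbhs.
by have [y Sy xy] := dS x e e0; exists y; split=> //; exact: eU.
Qed.

End normed_module.
End real_norm.

(** * Inner products and linear functions *)

Section inner_product.
Context {R : realType} {V : innerType R}.
Implicit Types x y z : V.

Lemma hdotC x y : hdot x y = Num.conj (hdot y x).
Proof. by rewrite hermC expr0 mul1r. Qed.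

Lemma hdotDl x y z : hdot (x + y) z = hdot x z + hdot y z.
Proof. exact: linearDl. Qed.
Lemma hdotDr x y z : hdot x (y + z) = hdot x y + hdot x z.
Proof. exact: linearDr. Qed.
Lemma hdotBl x y z : hdot (x - y) z = hdot x z - hdot y z.
Proof. exact: linearBl. Qed.
Lemma hdotBr x y z : hdot x (y - z) = hdot x y - hdot x z.
Proof. exact: linearBr. Qed.
Lemma hdotZl c x y : hdot (c *: x) y = c * hdot x y.
Proof. exact: linearZl_LR. Qed.
Lemma hdotZr c x y : hdot x (c *: y) = Num.conj c * hdot x y.
Proof. exact: linearZr_LR. Qed.
Lemma hdot0l y : hdot (0 : V) y = 0. Proof. exact: linear0l. Qed.
Lemma hdot0r x : hdot x (0 : V) = 0. Proof. exact: linear0r. Qed.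

Lemma hdot_nrm x : hdot x x = (nrm x ^+ 2)%:C.
Proof. by rewrite -hdotE rmorphXn/= nrmE. Qed.

Lemma nrm_hdot_le x y : nrm (hdot x y) <= nrm x * nrm y.
Proof.
rewrite -ler_sqr ?nnegrE ?mulr_ge0 ?nrm_ge0// -lecR rmorphXn/= nrmE.
by rewrite exprMn rmorphM/= -!hdot_nrm dot_CauchySchwarz.
Qed.

(** Testing [z] against vectors [w] close to [z] itself gives
    [|z|^2 <= C |z| + O(e)]. *)
Lemma nrm_le_dense (S : set V) (C : R) z : dense S -> 0 <= C ->
  (forall w, S w -> nrm (hdot z w) <= C * nrm w) -> nrm z <= C.
Proof.
move=> /denseP dS C0 zC; have [->|z0] := eqVneq z 0; first by rewrite nrm0.
have z_gt0 : 0 < nrm z by rewrite lt_neqAle eq_sym nrm_eq0 z0 nrm_ge0.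
rewrite -(ler_pM2r z_gt0); apply/ler_addgt0Pr => e e0.
have D0 : 0 < C + nrm z by rewrite ltr_wpDl.
have [w Sw zw] := dS z (e / (C + nrm z)) (divr_gt0 e0 D0).
have E : (nrm z * nrm z)%:C = hdot z w + hdot z (z - w).
  by rewrite -hdotDr addrC subrK hdot_nrm expr2.
have : nrm z * nrm z = nrm (hdot z w + hdot z (z - w)).
  by rewrite -E nrm_real ger0_norm// mulr_ge0// ltW.
move=> ->; apply: (le_trans (ler_nrmD _ _)).
have zw' := ltW zw.
have Hw : nrm w <= nrm z + e / (C + nrm z).
  have -> : w = z - (z - w) by rewrite subKr.
  by apply: (le_trans (ler_nrmB _ _)); rewrite lerD2l.
have H1 : nrm (hdot z w) <= C * (nrm z + e / (C + nrm z)).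
  by apply: (le_trans (zC _ Sw)); rewrite ler_wpM2l.
have H2 : nrm (hdot z (z - w)) <= nrm z * (e / (C + nrm z)).
  by apply: (le_trans (nrm_hdot_le _ _)); rewrite ler_wpM2l// nrm_ge0.
apply: (le_trans (lerD H1 H2)).
have : e / (C + nrm z) * (C + nrm z) = e by rewrite divfK// lt0r_neq0.
by move: (e / _) => d; lra.
Qed.

Lemma hdot_eq0_dense (S : set V) x : dense S ->
  (forall w, S w -> hdot x w = 0) -> x = 0.
Proof.
move=> dS xS; apply/eqP; rewrite -nrm_eq0 eq_le nrm_ge0 andbT.
by apply: (nrm_le_dense dS) => // w /xS ->; rewrite nrm0 mul0r.
Qed.

End inner_product.

Section linear_functions.
Context {K : pzRingType} {V W : lmodType K}.

Lemma linear_funD (T : V -> W) : linear T -> {morph T : x y / x + y}.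
Proof. by move=> lT x y; have := lT 1 x y; rewrite !scale1r. Qed.
Lemma linear_fun0 (T : V -> W) : linear T -> T 0 = 0.
Proof. by move=> lT; apply: (addrI (T 0)); rewrite -linear_funD// !addr0. Qed.
Lemma linear_funZ (T : V -> W) : linear T -> forall c, {morph T : x / c *: x}.
Proof. by move=> lT c x; have := lT c x 0; rewrite !addr0 linear_fun0// addr0. Qed.
Lemma linear_funN (T : V -> W) : linear T -> {morph T : x / - x}.
Proof. by move=> lT x; rewrite -scaleN1r linear_funZ// scaleN1r. Qed.
Lemma linear_funB (T : V -> W) : linear T -> {morph T : x y / x - y}.
Proof. by move=> lT x y; rewrite linear_funD// linear_funN. Qed.

End linear_functions.

(** * Bounded and compact operators *)

Section norm_continuity.
Context {R : realType} {V : normedModType R[i]}.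

Lemma lipschitz_nrm_continuous (W : normedModType R[i]) (f : V -> W) (C : R) :
  (forall x y, nrm (f x - f y) <= C * nrm (x - y)) -> continuous f.
Proof.
move=> fC x U /nbhs_nrmP[e e0 eU].
have C0 : 0 < `|C| + 1 by rewrite ltr_wpDl.
apply: filterS (nbhs_nrm x (divr_gt0 e0 C0)) => y /= xy; apply: eU.
apply: le_lt_trans (fC _ _) _; rewrite ltr_pdivlMr// in xy.
apply: le_lt_trans xy; rewrite mulrC ler_wpM2l ?nrm_ge0//.
by rewrite (le_trans (ler_norm C))// lerDl.
Qed.

Lemma nrm_continuous : continuous (fun x : V => nrm x : R).
Proof.
move=> x; apply/cvgrPdist_lt => e e0.
apply: filterS (nbhs_nrm x e0) => y; apply: le_lt_trans.
have := ler_nrmD (x - y) y; have := ler_nrmD (y - x) x.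
by rewrite !subrK (nrm_distC y) => *; rewrite ler_norml; apply/andP; split; lra.
Qed.

Lemma compact_nrm_bounded (K : set V) : compact K ->
  exists2 M : R, 0 <= M & forall x, K x -> nrm x <= M.
Proof.
move=> cK; have : compact ((nrm : V -> R^o) @` K).
  apply: continuous_compact cK; apply: continuous_subspaceT.
  exact: nrm_continuous.
move=> /compact_bounded[M [_ /(_ (M + 1))]]; rewrite ltrDl ltr01 => /(_ isT) HM.
exists `|M + 1| => // x Kx; have := HM (nrm x) (ex_intro2 _ _ _ Kx erefl).
rewrite /= ger0_norm ?nrm_ge0// => /le_trans; apply; exact: ler_norm.
Qed.

Lemma compact_add (K L : set V) : compact K -> compact L ->
  compact [set x + y | x in K & y in L].
Proof.
move=> cK cL.
have -> : [set x + y | x in K & y in L] = (fun z : V * V => z.1 + z.2) @` (K `*` L).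
  apply/seteqP; split=> [_ [x Kx [y Ly <-]]|_ [[x y] [/= Kx Ly] <-]].
    by exists (x, y).
  by exists x => //; exists y.
apply: continuous_compact; last exact: compact_setX.
by apply: continuous_subspaceT; exact: add_continuous.
Qed.

(** Two such segments, along [u] and ['i *: u], add up to a compact set
    containing a disc of the complex line through [u]. *)
Lemma compact_segment_scale (M : R) (u : V) :
  compact ((fun a : R => a%:C *: u) @` `[- M, M]).
Proof.
apply: continuous_compact; last exact: segment_compact.
apply: continuous_subspaceT => a U /nbhs_nrmP[e e0 eU].
have u0 : 0 < nrm u + 1 by rewrite ltr_wpDl// nrm_ge0.
have : nbhs a (ball a (e / (nrm u + 1))) by apply: nbhsx_ballx; exact: divr_gt0.
apply: filterS => b; rewrite -ball_normE/= => ab; apply: eU.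
rewrite -scalerBl -rmorphB nrmZ nrm_real; rewrite ltr_pdivlMr// in ab.
by apply: le_lt_trans ab; rewrite ler_wpM2l// lerDl.
Qed.

End norm_continuity.

Section bounded_operators.
Context {R : realType} {V : hilbertType R}.
Implicit Types (T S k : V -> V) (x y u v : V).

Lemma bounded_opP T : bounded_op T ->
  exists2 M : R, 0 < M & forall x, nrm (T x) <= M * nrm x.
Proof.
case=> _ [M HM]; exists (`|M| + 1); first by rewrite ltr_wpDl.
move=> x; apply: (le_trans (HM x)); rewrite ler_wpM2r ?nrm_ge0//.
by rewrite (le_trans (ler_norm M))// lerDl.
Qed.

Lemma linear_ball_bound T (M : R) : linear T ->
  (forall x, nrm x <= 1 -> nrm (T x) <= M) -> forall x, nrm (T x) <= M * nrm x.
Proof.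
move=> lT TM x; have [->|x0] := eqVneq x 0.
  by rewrite linear_fun0// !nrm0 mulr0.
have x_gt0 : 0 < nrm x by rewrite lt_neqAle eq_sym nrm_eq0 x0 nrm_ge0.
have := TM ((nrm x)^-1%:C *: x).
rewrite linear_funZ// !nrmZ nrm_real ger0_norm ?invr_ge0 ?nrm_ge0//.
rewrite mulVf ?gt_eqF// => /(_ (lexx _)).
by rewrite mulrC ler_pdivrMr.
Qed.

Lemma compact_opP T : compact_op T <->
  linear T /\ exists2 K, compact K & forall x, nrm x <= 1 -> K (T x).
Proof.
split=> [[lT [K KT [cK _]]]|[lT [K cK KT]]]; split=> //.
  by exists K => // x x1; apply: KT; exists x.
apply: (@precompact_subset _ _ K); first by move=> _ [x x1 <-]; exact: KT.
by apply: compact_precompact => //; exact: norm_hausdorff.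
Qed.

Lemma compact_op_bounded T : compact_op T -> bounded_op T.
Proof.
move=> /compact_opP[lT [K /compact_nrm_bounded[M _ KM] KT]]; split=> //.
by exists M; apply: linear_ball_bound => // x x1; exact/KM/KT.
Qed.

Lemma bounded_op_lin c T S :
  bounded_op T -> bounded_op S -> bounded_op (c *: T + S).
Proof.
move=> [lT [M HM]] [lS [N HN]]; split.
  move=> d x y; have E z : (c *: T + S) z = c *: T z + S z by [].
  rewrite !E lT lS !scalerDr !scalerA mulrC -!addrA.
  by congr (_ + _); rewrite addrCA.
exists (nrm c * M + N) => x; apply: (le_trans (ler_nrmD _ _)).
by rewrite mulrDl lerD// nrmZ -mulrA ler_wpM2l ?nrm_ge0.
Qed.

Lemma bounded_op0 : bounded_op (0 : V -> V).
Proof.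
split; first by move=> c x y; rewrite /= scaler0 addr0.
by exists 0 => x; rewrite nrm0 mul0r.
Qed.

Lemma bounded_opZ c T : bounded_op T -> bounded_op (c *: T).
Proof.
move=> bT; rewrite -[_ *: _]addr0.
by apply: bounded_op_lin => //; exact: bounded_op0.
Qed.

Lemma bounded_opD T S : bounded_op T -> bounded_op S -> bounded_op (T + S).
Proof. by move=> bT bS; rewrite -[T]scale1r; exact: bounded_op_lin. Qed.

Lemma bounded_opB T S : bounded_op T -> bounded_op S -> bounded_op (T - S).
Proof. by move=> bT bS; rewrite addrC -scaleN1r; exact: bounded_op_lin. Qed.

Lemma bounded_op_comp T S : bounded_op T -> bounded_op S -> bounded_op (T \o S).
Proof.
move=> bT bS; have [M M0 HM] := bounded_opP bT; have [N N0 HN] := bounded_opP bS.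
split; first by move=> c x y; rewrite /= bS.1 bT.1.
by exists (M * N) => x; apply: (le_trans (HM _)); rewrite -mulrA ler_pM2l.
Qed.

Lemma compact_op0 : compact_op (0 : V -> V).
Proof.
apply/compact_opP; split; first exact: bounded_op0.1.
by exists [set 0]; [exact: compact_set1|].
Qed.

Lemma compact_opD T S : compact_op T -> compact_op S -> compact_op (T + S).
Proof.
move=> cT cS; have [bT bS] := (compact_op_bounded cT, compact_op_bounded cS).
move: cT cS => /compact_opP[lT [K cK KT]] /compact_opP[lS [L cL LS]].
apply/compact_opP; split; first exact: (bounded_opD bT bS).1.
exists [set x + y | x in K & y in L]; first exact: compact_add.
by move=> x x1; exists (T x); [exact: KT|exists (S x) => //; exact: LS].
Qed.

Lemma compact_opZ c T : compact_op T -> compact_op (c *: T).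
Proof.
move=> cT; have bT := compact_op_bounded cT.
move: cT => /compact_opP[lT [K cK KT]].
apply/compact_opP; split; first exact: (bounded_opZ c bT).1.
exists ((fun x => c *: x) @` K); last by move=> x x1; exists (T x) => //; exact: KT.
apply: continuous_compact cK; apply: continuous_subspaceT.
apply: (@lipschitz_nrm_continuous _ _ _ _ (nrm c)) => x y.
by rewrite -scalerBr nrmZ.
Qed.

Lemma compact_opB T S : compact_op T -> compact_op S -> compact_op (T - S).
Proof.
move=> cT cS; apply: compact_opD => //.
by rewrite -scaleN1r; exact: compact_opZ.
Qed.

Lemma compact_op_compr T S : compact_op T -> bounded_op S -> compact_op (T \o S).
Proof.
move=> cT bS; have bT := compact_op_bounded cT; have [M M0 HM] := bounded_opP bS.
have /compact_opP[_ [K cK KT]] := compact_opZ M%:C cT.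
apply/compact_opP; split; first exact: (bounded_op_comp bT bS).1.
exists K => // x x1 /=.
have -> : T (S x) = M%:C *: T (M^-1%:C *: S x).
  rewrite -(linear_funZ bT.1) scalerA -rmorphM/= divff ?gt_eqF//.
  by rewrite rmorph1 scale1r.
apply: KT; rewrite nrmZ nrm_real ger0_norm; last by rewrite invr_ge0 ltW.
by rewrite ler_pdivrMl// mulr1 (le_trans (HM x))// ler_piMr// ltW.
Qed.

End bounded_operators.

Section adjoints.
Context {R : realType} {V : hilbertType R}.
Implicit Types (T S k : V -> V) (x y u v : V).

Lemma adjoint_bounded k S : bounded_op k -> is_adjoint k S -> linear S ->
  bounded_op S.
Proof.
move=> bk kS lS; split=> //; have [M M0 HM] := bounded_opP bk.
exists M => y; have [/eqP|Sy0] := eqVneq (nrm (S y)) 0.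
  by rewrite nrm_eq0 => /eqP ->; rewrite nrm0 mulr_ge0 ?nrm_ge0// ltW.
have Sy : 0 < nrm (S y) by rewrite lt_neqAle eq_sym Sy0 nrm_ge0.
rewrite -(ler_pM2r Sy).
have -> : nrm (S y) * nrm (S y) = nrm (hdot (k (S y)) y).
  by rewrite kS hdot_nrm nrm_real ger0_norm ?sqr_ge0// expr2.
rewrite (le_trans (nrm_hdot_le _ _))// mulrAC ler_wpM2r ?nrm_ge0//.
Qed.

(** Schauder: for [z], [w] in the closure of the image of the unit ball under
    [S = k^*] one has [|z - w|^2 <= 2 |k z - k w|], so an ultrafilter on this
    closure whose image under [k] converges is Cauchy. *)
Lemma adjoint_compact k S : compact_op k -> is_adjoint k S -> linear S ->
  compact_op S.
Proof.
move=> ck kS lS; have bk := compact_op_bounded ck; have lk := bk.1.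
have bS := adjoint_bounded bk kS lS.
split=> //; rewrite precompactE; set B := _ @` _.
have [_ [K cK KkS]] := (compact_opP _).1 (compact_op_compr ck bS).
have k_cont : continuous k.
  have [M M0 HM] := bounded_opP bk.
  by apply: (@lipschitz_nrm_continuous _ _ _ _ M) => x y; rewrite -(linear_funB lk).
have kK z : closure B z -> K (k z).
  have clK : closed (k @^-1` K).
    apply: preimage_closed; first by move=> x _; exact: k_cont.
    by apply: compact_closed => //; exact: norm_hausdorff.
  by move=> Bz; apply: clK; apply: closureS Bz => _ [x x1 <-]; exact: KkS.
have key z w : closure B z -> closure B w ->
    nrm (z - w) ^+ 2 <= 2 * nrm (k z - k w).
  move=> Bz Bw; rewrite -(linear_funB lk); set d := z - w.
  apply/ler_addgt0Pr => e e0.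
  have D0 : 0 < 2 * nrm d + 1 by rewrite ltr_wpDl// mulr_ge0// nrm_ge0.
  have h0 := divr_gt0 e0 D0; set h := e / _ in h0.
  have [_ [[x x1 <-] zx]] := Bz _ (nbhs_nrm z h0).
  have [_ [[y y1 <-] wy]] := Bw _ (nbhs_nrm w h0).
  rewrite /= in x1 y1 zx wy.
  have E : (nrm d ^+ 2)%:C = hdot (k d) (x - y) + hdot d ((z - S x) - (w - S y)).
    have dE : S x - S y + (z - S x - (w - S y)) = d.
      by rewrite opprB addrACA addKr [S x + _]addrC subrK.
    by rewrite kS (linear_funB lS) -hdotDr dE hdot_nrm.
  have -> : nrm d ^+ 2 = nrm ((nrm d ^+ 2)%:C : R[i]).
    by rewrite nrm_real ger0_norm ?sqr_ge0.
  rewrite E (le_trans (ler_nrmD _ _))// lerD//.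
    rewrite (le_trans (nrm_hdot_le _ _))// mulrC ler_wpM2r ?nrm_ge0//.
    by rewrite (le_trans (ler_nrmB _ _))//; lra.
  rewrite (le_trans (nrm_hdot_le _ _))//.
  apply: (@le_trans _ _ (nrm d * (h + h))).
    rewrite ler_wpM2l ?nrm_ge0//.
    by rewrite (le_trans (ler_nrmB _ _))// lerD// ltW.
  have -> : e = h * (2 * nrm d + 1) by rewrite divfK// gt_eqF.
  by clear zx wy E; move: h h0 => h' h0; lra.
rewrite compact_ultra => F UF FB.
have kFK : (k @ F) K by apply: (@filterS _ F _ (closure B)) FB => z Bz; exact: kK.
have [p [_ Fp]] := cK (k @ F) _ kFK.
have cF : cauchy F.
  apply/cauchy_exP => e e0.
  have eE : e = (complex.Re e)%:C by rewrite RRe_real// gtr0_real.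
  set r := complex.Re e in eE.
  have r0 : 0 < r by rewrite -ltcR -eE.
  have r4 : 0 < r ^+ 2 / 5 by rewrite divr_gt0// exprn_gt0.
  have FN : F (k @^-1` [set y | nrm (p - y) < r ^+ 2 / 5]).
    pose N : set V := [set y | nrm (p - y) < r ^+ 2 / 5].
    have [//|Fn] := in_ultra_setVsetC (k @^-1` N) UF.
    by have [q [/= ? ?]] := Fp (~` N) _ Fn (nbhs_nrm p r4).
  have FNB : F (k @^-1` [set y | nrm (p - y) < r ^+ 2 / 5] `&` closure B).
    exact: filterI.
  have [z [/= pz Bz]] := filter_ex FNB.
  exists z; apply: filterS FNB => w [/= pw Bw].
  rewrite -ball_normE/= -nrmE eE ltcR -ltr_sqr ?nnegrE ?nrm_ge0 ?ltW//.
  apply: (le_lt_trans (key _ _ Bz Bw)).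
  have -> : k z - k w = (p - k w) - (p - k z).
    by rewrite opprB [RHS]addrC addrA subrK.
  have := ler_nrmB (p - k w) (p - k z); lra.
have /cvg_ex[q Fq] : cvg F by exact: cauchy_cvg.
exists q; split=> //=; apply: closed_closure => N Nq.
have FBN : F (closure B `&` N) by apply: filterI => //; exact: Fq.
by have [z Hz] := filter_ex FBN; exists z.
Qed.

Definition rank_one u v : V -> V := fun x => hdot x v *: u.

Lemma rank_one_compact u v : compact_op (rank_one u v).
Proof.
apply/compact_opP; split.
  by move=> c x y; rewrite /rank_one hdotDl hdotZl scalerDl scalerA.
exists [set x + y | x in (fun a : R => a%:C *: u) @` `[- nrm v, nrm v] &
                    y in (fun a : R => a%:C *: ('i *: u)) @` `[- nrm v, nrm v]].
  by apply: compact_add; exact: compact_segment_scale.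
move=> x x1; rewrite /rank_one.
have bnd : nrm (hdot x v) <= nrm v.
  by rewrite (le_trans (nrm_hdot_le _ _))// ler_piMl// nrm_ge0.
move: (hdot x v) bnd => [a b] bnd.
have normc : (nrm (a +i* b)) ^+ 2 = a ^+ 2 + b ^+ 2.
  apply: (@complexI R); rewrite rmorphXn/= nrmE normc_def/= -rmorphXn/=.
  by rewrite sqr_sqrtr// addr_ge0// sqr_ge0.
have v0 := nrm_ge0 v; have c0 := nrm_ge0 (a +i* b).
have bnd2 : a ^+ 2 + b ^+ 2 <= nrm v ^+ 2.
  by rewrite -normc ler_sqr ?nnegrE.
have seg (r : R) : r ^+ 2 <= nrm v ^+ 2 -> `[- nrm v, nrm v]%classic r.
  by rewrite -ler_sqrt ?sqr_ge0// !sqrtr_sqr (ger0_norm v0) ler_norml /= in_itv.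
exists (a%:C *: u).
  by exists a => //; apply: seg; apply: le_trans bnd2; rewrite lerDl sqr_ge0.
exists (b%:C *: ('i *: u)).
  by exists b => //; apply: seg; apply: le_trans bnd2; rewrite lerDr sqr_ge0.
rewrite scalerA -scalerDl; congr (_ *: _); rewrite [RHS]complexE/= complexiE.
by rewrite [in RHS]mulrC.
Qed.

End adjoints.

Section unorm_bounds.
Context {R : realType} {V : hilbertType R}.
Implicit Types T : uop V.

Lemma unorm_ge T x : udom T x -> nrm x <= 1 -> ((nrm (ufun T x))%:E <= unorm T)%E.
Proof. by move=> Tx x1; apply: ereal_sup_ubound; exists x. Qed.

Lemma unorm_le T M : (forall x, udom T x -> nrm x <= 1 ->
  ((nrm (ufun T x))%:E <= M)%E) -> (unorm T <= M)%E.
Proof. by move=> TM; apply: ge_ereal_sup => _ [x [Tx x1] <-]; exact: TM. Qed.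

Lemma udom_commutator T (a : V -> V) x :
  udom (commutator T a) x <-> udom T (a x) /\ udom T x.
Proof. by split=> [[[_ ?] [? _]]|[]]. Qed.

Lemma udom_commutator_compressed T (a : V -> V) (Q : orthoproj V) x :
  udom (commutator (compressed T Q) a) x <-> udom T (a x) /\ udom T x.
Proof. by split=> [[[_ [? _]] [[? _] _]]|[]]. Qed.

Lemma densely_boundedP T : densely_bounded T ->
  dense (udom T) /\
  exists2 M : R, 0 <= M & forall x, udom T x -> nrm (ufun T x) <= M * nrm x.
Proof.
case=> dT [M HM]; split=> //; exists `|M| => // x Tx.
by rewrite (le_trans (HM x Tx))// ler_wpM2r ?nrm_ge0// ler_norm.
Qed.

End unorm_bounds.

(** * Finite rank projections *)

Section finite_projections.
Context {R : realType} {V : hilbertType R}.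
Implicit Types (x y z u v e : V) (E : orthoproj V).

Lemma orthoproj0 : exists E, forall x, E x = 0.
Proof.
pose z : {linear V -> V} := \0.
have id0 x : z (z x) = z x by [].
have sym0 x y : hdot (z x) y = hdot x (z y) by rewrite hdot0l hdot0r.
by exists (OrthoProj id0 sym0).
Qed.

(** One Gram-Schmidt step. *)
Lemma orthoproj_add E e : hdot e e = 1 -> E e = 0 ->
  exists E', forall x, E' x = E x + hdot x e *: e.
Proof.
move=> ee Ee.
have Eze z : hdot (E z) e = 0 by rewrite oproj_sym Ee hdot0r.
pose f z := E z + hdot z e *: e.
have lf : linear f.
  move=> c x y; rewrite /f linearP hdotDl hdotZl scalerDl scalerDr scalerA.
  by rewrite addrACA.
pose g : {linear V -> V} := HB.pack f (GRing.isLinear.Build R[i] V V _ f lf).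
have gK x : g (g x) = g x.
  rewrite -[LHS]/(E (E x + hdot x e *: e) + hdot (E x + hdot x e *: e) e *: e).
  rewrite linearD linearZ/= oproj_idem Ee scaler0 addr0.
  by rewrite hdotDl hdotZl Eze ee mulr1 add0r.
have gS x y : hdot (g x) y = hdot x (g y).
  rewrite -[g x]/(E x + hdot x e *: e) -[g y]/(E y + hdot y e *: e).
  by rewrite hdotDl hdotDr oproj_sym hdotZl hdotZr -hdotC mulrC.
by exists (OrthoProj gK gS).
Qed.

(** By Gram-Schmidt, one vector at a time; a vector fixed by the projection
    built so far adds nothing to it. *)
Lemma finite_projection (s : seq V) : exists E (us : seq V),
  (forall x, E x = \sum_(e <- us) hdot x e *: e) /\
  (forall x, x \in s -> E x = x).
Proof.
elim: s => [|x s [E [us [EE Es]]]].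
  by have [E E0] := orthoproj0; exists E, [::]; split=> // x; rewrite big_nil.
have [xE|yN0] := eqVneq (x - E x) 0.
  exists E, us; split=> // z; rewrite inE => /predU1P[->|]; last exact: Es.
  by apply/eqP; rewrite eq_sym -subr_eq0 xE.
set y := x - E x in yN0.
have y0 : 0 < nrm y by rewrite lt_neqAle eq_sym nrm_eq0 yN0 nrm_ge0.
have Ey : E y = 0 by rewrite linearB/= oproj_idem subrr.
pose e := (nrm y)^-1%:C *: y.
have ee : hdot e e = 1.
  rewrite hdot_nrm nrmZ nrm_real ger0_norm ?invr_ge0 ?nrm_ge0//.
  by rewrite mulVf ?gt_eqF// expr1n.
have Ee : E e = 0 by rewrite linearZ/= Ey scaler0.
have [E' E'E] := orthoproj_add ee Ee.
exists E', (e :: us); split=> [z|z]; first by rewrite E'E EE big_cons addrC.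
have Eze w : hdot (E w) e = 0 by rewrite oproj_sym Ee hdot0r.
rewrite inE => /predU1P[->|zs]; rewrite E'E; last first.
  by rewrite -{2}(Es z zs) Eze scale0r addr0 Es.
have -> : hdot x e = (nrm y)%:C.
  have -> : x = y + E x by rewrite subrK.
  rewrite hdotDl Eze addr0 hdotZr hdot_nrm conj_Creal ?complex_real//.
  by rewrite -rmorphM/= expr2 mulrA mulVf ?gt_eqF// mul1r.
by rewrite scalerA -rmorphM/= divff ?gt_eqF// scale1r addrC subrK.
Qed.

(** Expanding both projections in the same finite family reduces the
    compression of [T] to rank one operators. *)
Lemma compression_sum E (us : seq V) (T : V -> V) : linear T ->
  (forall x, E x = \sum_(e <- us) hdot x e *: e) ->
  (E : V -> V) \o T \o E =
  \sum_(e <- us) \sum_(e' <- us) hdot (T e') e *: rank_one e e'.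
Proof.
move=> lT EE; apply/funext => x /=.
have Tsum (r : seq V) (c : V -> R[i]) :
    T (\sum_(e <- r) c e *: e) = \sum_(e <- r) c e *: T e.
  elim: r => [|e r IH]; first by rewrite !big_nil linear_fun0.
  by rewrite !big_cons lT IH.
rewrite [LHS]EE EE Tsum fct_sumE; apply: eq_bigr => e _; rewrite fct_sumE.
have -> : hdot (\sum_(e0 <- us) hdot x e0 *: T e0) e =
    \sum_(e0 <- us) hdot x e0 * hdot (T e0) e.
  elim: us {EE} => [|e1 r IH]; first by rewrite !big_nil hdot0l.
  by rewrite !big_cons hdotDl hdotZl IH.
rewrite scaler_suml; apply: eq_bigr => e' _.
by rewrite -[RHS]/(hdot (T e') e *: (hdot x e' *: e)) scalerA mulrC.
Qed.

End finite_projections.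

(** * Ultraweakly continuous functionals *)

Section ultraweak.
Context {R : realType} {V : hilbertType R}.
Implicit Types (T : V -> V) (F G : functional V) (E : orthoproj V) (x y : nat -> V).

Lemma square_summable_tail x (e : R) : 0 < e -> square_summable x ->
  exists N0 : nat, forall N M : nat, (N0 <= N)%N ->
    \sum_(N <= n < M) nrm (x n) ^+ 2 <= e.
Proof.
move=> e0 sx.
have pos (k : nat) : true -> (0 <= (nrm (x k) ^+ 2)%:E)%E.
  by move=> _; rewrite lee_fin sqr_ge0.
have := nneseries_tail_cvg sx pos.
move=> /fine_cvgP[Hfin /cvgrPdist_lt /(_ e e0)].
move=> [N1 _ HN1]; case: Hfin => N2 _ HN2.
exists (maxn N1 N2) => N M; rewrite geq_max => /andP[N1N N2N].
have := HN1 N N1N; rewrite /= sub0r normrN => /(le_lt_trans (ler_norm _)).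
move=> /ltW; apply: le_trans; rewrite -lee_fin fineK; last exact: HN2.
rewrite -sumEFin; apply: nneseries_lim_ge => n _ _; exact: pos.
Qed.

(** Also when the series diverges: its formal limit is then the default value
    [0]. *)
Lemma ultraweak_form_le x y T (c : R) : 0 <= c ->
  (forall M : nat, nrm (\sum_(n < M) hdot (T (x n)) (y n)) <= c) ->
  nrm (ultraweak_form x y T) <= c.
Proof.
move=> c0 pc; rewrite /ultraweak_form.
set p := (fun N => _) : nat -> R[i]^o.
have [cp|/dvgP ->] := pselect (cvg (p @ \oo)); last first.
  by rewrite [X in nrm X](_ : _ = 0)// nrm0.
rewrite leNgt; apply/negP => clt.
have e0 : 0 < nrm (limn p) - c by rewrite subr_gt0.
have [N _ HN] := cp _ (@nbhs_nrm _ R[i]^o (limn p) _ e0).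
have := HN N (leqnn N); rewrite /= => h.
have := pc N; rewrite -/(p N) => h2.
have := ler_nrmD ((limn p : R[i]^o) - p N) (p N); rewrite subrK => h3.
by move: (le_lt_trans h3 (ltr_leD h h2)); rewrite subrK ltxx.
Qed.

(** An ultraweakly continuous functional only sees finitely many vectors up to
    a small error; a projection fixing these can be inserted on both sides. *)
Lemma ultraweak_compression F T (e : R) : ultraweakly_continuous F ->
  bounded_op T -> 0 < e -> exists s : seq V, forall E,
    (forall v, v \in s -> E v = v) -> nrm (F (T - ((E : V -> V) \o T \o E))) < e.
Proof.
move=> Fc bT e0; have [m [x [y [d [sxy d0 Fd]]]]] := Fc e e0.
have [M M0 HM] := bounded_opP bT.
(* With |T - E T E| <= 2 M, tails of size d / (8 M) contribute at most d / 4. *)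
have c0 : 0 < d / (8 * M) by rewrite divr_gt0// mulr_gt0.
have tails i : exists N0 : nat, forall N N' : nat, (N0 <= N)%N ->
    \sum_(N <= n < N') nrm (x i n) ^+ 2 <= d / (8 * M) /\
    \sum_(N <= n < N') nrm (y i n) ^+ 2 <= d / (8 * M).
  have [sx sy] := sxy i.
  have [N1 H1] := square_summable_tail c0 sx.
  have [N2 H2] := square_summable_tail c0 sy.
  exists (maxn N1 N2) => N N'; rewrite geq_max => /andP[N1N N2N].
  by split; [exact: H1|exact: H2].
have [N HN] := choice tails.
exists (flatten [seq [seq x i n | n <- iota 0 (N i)] ++
                     [seq y i n | n <- iota 0 (N i)] | i <- enum 'I_m]) => E Es.
have bE : bounded_op (E : V -> V).
  split; first by move=> c u v; rewrite linearP.
  by exists 1 => v; rewrite mul1r ler_nrm oproj_norm_le.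
set T' := T - _.
have bT' : bounded_op T'.
  by apply: bounded_opB => //; apply: bounded_op_comp => //; exact: bounded_op_comp.
have T'E v : T' v = T v - E (T (E v)) by [].
have HT' v : nrm (T' v) <= 2 * M * nrm v.
  rewrite T'E (le_trans (ler_nrmB _ _))//.
  rewrite -mulrA mulr_natl mulr2n lerD//.
  apply: (@le_trans _ _ (nrm (T (E v)))); first by rewrite ler_nrm oproj_norm_le.
  by rewrite (le_trans (HM _))// ler_pM2l// ler_nrm oproj_norm_le.
have mem_s i n (z : V) : (n < N i)%N -> z = x i n \/ z = y i n -> E z = z.
  move=> nN zE; apply: Es; apply/flattenP.
  exists ([seq x i n | n <- iota 0 (N i)] ++ [seq y i n | n <- iota 0 (N i)]).
    by apply: map_f; rewrite mem_enum.
  rewrite mem_cat; case: zE => ->; apply/orP; [left|right]; apply: map_f;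
    by rewrite mem_iota.
(* The first [N i] terms of the series vanish and the others are bounded by
   the square summable tails. *)
apply: Fd => // i; apply: (@le_lt_trans _ _ (d / 2)); last by lra.
apply: ultraweak_form_le => [|N']; first by rewrite divr_ge0// ltW.
rewrite -(big_mkord xpredT (fun n => hdot (T' (x i n)) (y i n))).
have head n : (n < N i)%N -> hdot (T' (x i n)) (y i n) = 0.
  move=> nN; rewrite T'E hdotBl oproj_sym (mem_s i n (x i n))//; last by left.
  by rewrite (mem_s i n (y i n)) ?subrr//; right.
have [N'N|NN'] := leqP N' (N i).
  rewrite big_nat big1 ?nrm0 ?divr_ge0 ?ltW// => n /andP[_ nN'].
  by rewrite head// (leq_trans nN').
rewrite (big_cat_nat (n := N i))//=; last exact: ltnW.
rewrite big_nat big1 ?add0r; last by move=> n /andP[_ nN]; exact: head.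
apply: (le_trans (nrm_sum _ _ _)).
have [H1 H2] := HN i (N i) N' (leqnn _).
apply: (@le_trans _ _
  (\sum_(N i <= n < N') M * (nrm (x i n) ^+ 2 + nrm (y i n) ^+ 2))).
  apply: ler_sum => n _; apply: (le_trans (nrm_hdot_le _ _)).
  apply: (@le_trans _ _ (2 * M * nrm (x i n) * nrm (y i n))).
    by rewrite ler_wpM2r ?nrm_ge0.
  rewrite (_ : 2 * M * _ * _ = M * (2 * nrm (x i n) * nrm (y i n))); last by ring.
  rewrite ler_pM2l//; have := sqr_ge0 (nrm (x i n) - nrm (y i n)); nra.
rewrite -mulr_sumr big_split/=.
apply: (@le_trans _ _ (M * (d / (8 * M) + d / (8 * M)))).
  by rewrite ler_pM2l// lerD.
rewrite (_ : M * _ = d / 4); first by lra.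
by field; rewrite gt_eqF.
Qed.

Lemma linear_on0 (S : set (V -> V)) F : S 0 -> linear_on S F -> F 0 = 0.
Proof.
move=> S0 lF; have := lF 1 0 0 S0 S0; rewrite scaler0 addr0 mul1r.
by move/eqP; rewrite -subr_eq0 opprD addrA subrr sub0r oppr_eq0 => /eqP.
Qed.

(** Combinations of rank one operators are ultraweakly dense in all bounded
    operators. *)
Lemma ultraweak_eq_rank_one F G :
  linear_on bounded_op F -> linear_on bounded_op G ->
  ultraweakly_continuous F -> ultraweakly_continuous G ->
  (forall u v, F (rank_one u v) = G (rank_one u v)) -> eq_on bounded_op F G.
Proof.
move=> lF lG cF cG FG T bT.
apply/eqP; rewrite -subr_eq0 -nrm_eq0 eq_le nrm_ge0 andbT.
apply/ler_addgt0Pr => e e0; rewrite add0r.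
have e20 : 0 < e / 2 by rewrite divr_gt0.
have [s1 Hs1] := ultraweak_compression cF bT e20.
have [s2 Hs2] := ultraweak_compression cG bT e20.
have [E [us [EE Es]]] := finite_projection (s1 ++ s2).
have HF : nrm (F (T - ((E : V -> V) \o T \o E))) < e / 2.
  by apply: Hs1 => v vs; apply: Es; rewrite mem_cat vs.
have HG : nrm (G (T - ((E : V -> V) \o T \o E))) < e / 2.
  by apply: Hs2 => v vs; apply: Es; rewrite mem_cat vs orbT.
pose good S := bounded_op S /\ F S = G S.
have good_lin c S S' : good S -> good S' -> good (c *: S + S').
  move=> [bS FS] [bS' FS']; split; first exact: bounded_op_lin.
  by rewrite lF// lG// FS FS'.
have good0 : good 0.
  split; first exact: bounded_op0.
  by rewrite !(@linear_on0 bounded_op)//; exact: bounded_op0.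
have [bS FS] : good ((E : V -> V) \o T \o E).
  rewrite (compression_sum bT.1 EE); elim/big_ind : _ => //.
    by move=> S S' gS gS'; rewrite -[S]scale1r; exact: good_lin.
  move=> u _; elim/big_ind : _ => //.
    by move=> S S' gS gS'; rewrite -[S]scale1r; exact: good_lin.
  move=> v _; rewrite -[X in good X]addr0; apply: good_lin => //.
  by split; [exact/compact_op_bounded/rank_one_compact|exact: FG].
have subE (K : functional V) : linear_on bounded_op K ->
    K T = K (T - ((E : V -> V) \o T \o E)) + K ((E : V -> V) \o T \o E).
  move=> lK; rewrite -[X in X + _]mul1r -lK//; last exact: bounded_opB.
  by rewrite scale1r subrK.
rewrite (subE F lF) (subE G lG) FS opprD addrACA subrr addr0.
by rewrite (le_trans (ler_nrmB _ _))//; lra.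
Qed.

End ultraweak.

(** * Bounded functionals on rank one operators *)

Section functionals.
Context {R : realType} {V : hilbertType R}.
Implicit Types (S : set (V -> V)) (f g mu nu : functional V).

Lemma opnorm_le (T : V -> V) (c : R) : 0 <= c ->
  (forall x, nrm (T x) <= c * nrm x) -> (opnorm T <= c%:E)%E.
Proof.
move=> c0 Tc; apply: unorm_le => x _ x1; rewrite lee_fin (le_trans (Tc x))//.
by rewrite ler_piMr.
Qed.

Lemma fnorm_ge0 S f : S 0 -> (0 <= fnorm S f)%E.
Proof.
move=> S0; apply: (@le_trans _ _ (nrm (f 0))%:E); first by rewrite lee_fin nrm_ge0.
apply: ereal_sup_ubound; exists 0 => //; split=> //.
apply: (@le_trans _ _ (0%:E)); last by rewrite lee_fin.
by apply: opnorm_le => // x; rewrite nrm0 mul0r.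
Qed.

Lemma fnorm_bound S f (m c : R) a : linear_on S f -> S 0 ->
  (forall k b, S b -> S (k *: b)) -> (fnorm S f <= m%:E)%E -> S a -> 0 < c ->
  (forall x, nrm (a x) <= c * nrm x) -> nrm (f a) <= m * c.
Proof.
move=> lf S0 SZ fm Sa c0 ac.
have fZ : f (c^-1%:C *: a) = c^-1%:C * f a.
  by rewrite -[_ *: a]addr0 lf// (linear_on0 S0 lf) addr0.
have : ((nrm (f (c^-1%:C *: a)))%:E <= fnorm S f)%E.
  apply: ereal_sup_ubound; exists (c^-1%:C *: a) => //; split; first exact: SZ.
  apply: opnorm_le => // x; rewrite -[(_ *: a) x]/(c^-1%:C *: a x) nrmZ nrm_real.
  by rewrite ger0_norm ?invr_ge0 ?(ltW c0)// ler_pdivrMl// mul1r ac.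
move=> /le_trans /(_ fm); rewrite lee_fin fZ nrmM nrm_real.
by rewrite ger0_norm ?invr_ge0 ?(ltW c0)// ler_pdivrMl// mulrC.
Qed.

Lemma fnorm_eq_on S f g : eq_on S f g -> fnorm S f = fnorm S g.
Proof.
move=> fg; rewrite /fnorm; congr ereal_sup; apply/seteqP.
by split=> _ [a [Sa a1] <-]; exists a => //; rewrite fg.
Qed.

Lemma rank_one_le (u v x : V) : nrm (rank_one u v x) <= nrm u * nrm v * nrm x.
Proof.
rewrite nrmZ mulrC -mulrA ler_wpM2l ?nrm_ge0// mulrC.
exact: nrm_hdot_le.
Qed.

(** Continuity in [u] extends the agreement from the dense set [S] to all
    [<., u> u]; polarization then gives all rank one operators. *)
Lemma rank_one_diag_eq f g (S : set V) : dense S ->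
  linear_on compact_op f -> linear_on compact_op g ->
  (fnorm compact_op f <= 1)%E -> (fnorm compact_op g <= 1)%E ->
  (forall u, S u -> f (rank_one u u) = g (rank_one u u)) ->
  forall u v, f (rank_one u v) = g (rank_one u v).
Proof.
move=> /denseP dS lf lg f1 g1 fg.
have diag u : f (rank_one u u) = g (rank_one u u).
  apply/eqP; rewrite -subr_eq0 -nrm_eq0 eq_le nrm_ge0 andbT.
  apply/ler_addgt0Pr => e e0; rewrite add0r.
  have C0 : 0 < 4 * nrm u + 2 by rewrite ltr_wpDl// mulr_ge0// nrm_ge0.
  (* For |u - u'| <= 1 the operator d below has norm at most
     (|u| + |u'|) |u - u'| <= (2 |u| + 1) |u - u'|. *)
  have h0 : 0 < Num.min 1 (e / (4 * nrm u + 2)) by rewrite lt_min ltr01 divr_gt0.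
  have [u' Su' uu'] := dS u _ h0.
  move: uu'; rewrite lt_min => /andP[uu1 uu2].
  set d := rank_one u u - rank_one u' u'.
  have cd : compact_op d by apply: compact_opB; exact: rank_one_compact.
  have dE x : d x = rank_one (u - u') u x + rank_one u' (u - u') x.
    rewrite -[d x]/(hdot x u *: u - hdot x u' *: u').
    rewrite /rank_one hdotBr scalerBr scalerBl.
    by rewrite addrA subrK.
  have nu' : nrm u' <= nrm u + 1.
    have -> : u' = u - (u - u') by rewrite subKr.
    by rewrite (le_trans (ler_nrmB _ _))// lerD2l ltW.
  have dle x : nrm (d x) <= (2 * nrm u + 1) * nrm (u - u') * nrm x.
    rewrite dE (le_trans (ler_nrmD _ _))//.
    have := rank_one_le (u - u') u x; have := rank_one_le u' (u - u') x.
    have : nrm (u - u') * nrm x * nrm u' <= nrm (u - u') * nrm x * (nrm u + 1).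
      by rewrite ler_wpM2l// mulr_ge0// nrm_ge0.
    lra.
  have c2 : 0 < e / 2 by rewrite divr_gt0.
  have dle2 x : nrm (d x) <= e / 2 * nrm x.
    rewrite (le_trans (dle x))// ler_wpM2r ?nrm_ge0//.
    rewrite ltr_pdivlMr// in uu2; lra.
  have SZ k b : compact_op b -> compact_op (k *: b) := @compact_opZ _ V k b.
  have fd := fnorm_bound lf compact_op0 SZ f1 cd c2 dle2.
  have gd := fnorm_bound lg compact_op0 SZ g1 cd c2 dle2.
  have uE : rank_one u u = 1 *: d + rank_one u' u' by rewrite scale1r subrK.
  rewrite uE lf ?lg//; try exact: rank_one_compact.
  rewrite (fg _ Su') !mul1r opprD addrACA subrr addr0.
  by rewrite (le_trans (ler_nrmB _ _))//; lra.
move=> u v; pose good T := compact_op T /\ f T = g T.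
have good_lin c T T' : good T -> good T' -> good (c *: T + T').
  move=> [cT fT] [cT' fT']; split.
    by apply: compact_opD => //; exact: compact_opZ.
  by rewrite lf// lg// fT fT'.
have gd w : good (rank_one w w) by split; [exact: rank_one_compact|exact: diag].
(* For |c| = 1 this is c <., u> v + c^* <., v> u. *)
pose W c := -1 *: rank_one v v +
  (-1 *: rank_one u u + rank_one (u + c *: v) (u + c *: v)).
have gW c : good (W c).
  exact: (good_lin _ _ _ (gd v) (good_lin _ _ _ (gd u) (gd _))).
have WE c x : c * Num.conj c = 1 ->
    W c x = (c * hdot x u) *: v + (Num.conj c * hdot x v) *: u.
  move=> cc; rewrite -[W c x]/(-1 *: (hdot x v *: v) + (-1 *: (hdot x u *: u) +
     hdot x (u + c *: v) *: (u + c *: v))).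
  rewrite hdotDr hdotZr !scaleN1r; set s := hdot x u; set r := hdot x v.
  have -> : (s + Num.conj c * r) *: (u + c *: v) =
      s *: u + (r *: v + ((c * s) *: v + (Num.conj c * r) *: u)).
    rewrite scalerDr scalerA (_ : (s + Num.conj c * r) * c = c * s + r).
      rewrite !scalerDl -[LHS]addrA; congr (_ + _).
      by rewrite addrC [_ + r *: v]addrC -addrA.
    by rewrite mulrDl [s * c]mulrC mulrAC [_ * c]mulrC cc mul1r.
  by rewrite !addKr.
suff -> : rank_one u v = 2^-1 *: W 1 + (2^-1 * 'i *: W 'i + 0).
  have g0 := compact_op0 (V := V).
  have good0 : good 0 by split=> //; rewrite (linear_on0 _ lf)// (linear_on0 _ lg).
  by case: (good_lin 2^-1 _ _ (gW 1) (good_lin (2^-1 * 'i) _ _ (gW 'i) good0)).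
apply/funext => x.
rewrite -[RHS]/(2^-1 *: W 1 x + ((2^-1 * 'i) *: W 'i x + 0)) addr0.
rewrite !WE ?conjC1 ?mulr1// ?conjCi ?mulrN -?expr2 ?sqrCi ?opprK//.
rewrite !scalerDr !scalerA addrACA -!scalerDl.
have ii : 'i * 'i = -1 :> R[i] by rewrite -expr2 sqrCi.
have -> : 2^-1 * (1 * hdot x u) + 2^-1 * 'i * ('i * hdot x u) = 0.
  by rewrite [2^-1 * 'i * _]mulrA -[2^-1 * 'i * 'i]mulrA ii; ring.
have -> : 2^-1 * (1 * hdot x v) + 2^-1 * 'i * (- 'i * hdot x v) = hdot x v.
  rewrite [2^-1 * 'i * _]mulrA -[2^-1 * 'i * - 'i]mulrA mulrN ii opprK mulr1 mul1r.
  by rewrite ![2^-1 * _]mulrC -splitr.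
by rewrite scale0r add0r.
Qed.

End functionals.

(** * Projections commuting with a self-adjoint operator *)

Section moments.
Context {R : realType}.
Implicit Types m : {measure set (measurableTypeR R) -> \bar R}.

(** From [|l| <= 1 + l^2] and the finiteness of the measure. *)
Lemma integrable_moment m : (m setT < +oo)%E ->
  (\int[m]_l (l ^+ 2)%:E < +oo)%E -> m.-integrable setT (fun l => l%:E).
Proof.
move=> mfin m2fin; apply/integrableP; split; first exact/measurable_EFinP.
have mE2 : measurable_fun setT (fun l : measurableTypeR R => (l ^+ 2)%:E).
  by apply/measurable_EFinP; exact: measurable_funX.
apply: (@le_lt_trans _ _ (\int[m]_l (1 + (l ^+ 2)%:E))%E).
  apply: ge0_le_integral => //=.
  - by apply: measurableT_comp => //; exact/measurable_EFinP.
  - by apply: emeasurable_funD.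
  - move=> l _; rewrite -EFinD lee_fin.
    have := sqr_ge0 (`|l| - 1); rewrite -(real_normK (num_real l)).
    have := normr_ge0 l; nra.
rewrite ge0_integralD//=; last by move=> l _; rewrite lee_fin sqr_ge0.
by rewrite integral_cst//= mul1e lte_add_pinfty.
Qed.

Lemma moment_split m m1 m2 :
  (forall S, measurable S -> m S = m1 S + m2 S)%E -> (m setT < +oo)%E ->
  (\int[m]_l (l ^+ 2)%:E < +oo)%E ->
  [/\ (\int[m1]_l (l ^+ 2)%:E < +oo)%E, (\int[m2]_l (l ^+ 2)%:E < +oo)%E &
      \int[m]_l l = \int[m1]_l l + \int[m2]_l l].
Proof.
move=> mD mfin m2fin.
have mE (f : measurableTypeR R -> \bar R) :
    (\int[m]_l f l = \int[measure_add m1 m2]_l f l)%E.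
  apply: eq_measure_integral => S mS _.
  by rewrite -[RHS]/(msum _ _ _) /msum/= !big_ord_recl big_ord0/= adde0 mD.
have mE2 : measurable_fun setT (fun l : measurableTypeR R => (l ^+ 2)%:E).
  by apply/measurable_EFinP; exact: measurable_funX.
have sq0 m' : (0 <= \int[m']_l (l ^+ 2)%:E)%E.
  by apply: integral_ge0 => l _; rewrite lee_fin sqr_ge0.
have := m2fin; rewrite mE ge0_integral_measure_add//; last first.
  by move=> l _; rewrite lee_fin sqr_ge0.
move=> m12.
have fin1 : (\int[m1]_l (l ^+ 2)%:E < +oo)%E.
  by apply: le_lt_trans m12; rewrite leeDl.
have fin2 : (\int[m2]_l (l ^+ 2)%:E < +oo)%E.
  by apply: le_lt_trans m12; rewrite leeDr.
have mT : (m setT = m1 setT + m2 setT)%E by exact: mD.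
have i1 : m1.-integrable setT (fun l => l%:E).
  apply: integrable_moment => //; apply: le_lt_trans mfin.
  by rewrite mT leeDl.
have i2 : m2.-integrable setT (fun l => l%:E).
  apply: integrable_moment => //; apply: le_lt_trans mfin.
  by rewrite mT leeDr.
split=> //; rewrite /Rintegral mE integral_measure_add//.
by rewrite fineD//; exact: integrable_fin_num.
Qed.

End moments.

Section projections.
Context {R : realType} {H : hilbertType R}.
Implicit Types (P Q : orthoproj H) (x y : H).

Lemma oproj_complE P x : oproj_compl P x = x - P x. Proof. by []. Qed.

Lemma oproj_add_compl P x : P x + oproj_compl P x = x.
Proof. by rewrite oproj_complE addrC subrK. Qed.

Lemma compl_oproj0 P x : oproj_compl P (P x) = 0.
Proof. by rewrite oproj_complE oproj_idem subrr. Qed.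

Lemma oproj_compl0 P x : P (oproj_compl P x) = 0.
Proof. by rewrite oproj_complE linearB/= oproj_idem subrr. Qed.

Lemma oproj_ortho P x y : hdot (P x) (oproj_compl P y) = 0.
Proof. by rewrite oproj_sym oproj_compl0 hdot0r. Qed.

End projections.

Section reducing.
Context {R : realType} {H : hilbertType R} (D : uop H) (P : orthoproj H).
Hypotheses (saD : self_adjoint D) (PD : commutes_with P D).
Local Notation Q := (oproj_compl P).

Lemma uop_linear x y c : udom D x -> udom D y ->
  udom D (c *: x + y) /\ ufun D (c *: x + y) = c *: ufun D x + ufun D y.
Proof. by case: saD => -[_ +] _ _; apply. Qed.

Lemma udom_at0 : udom D 0. Proof. by case: saD => -[]. Qed.

Lemma uop_sym x y : udom D x -> udom D y ->
  hdot (ufun D x) y = hdot x (ufun D y).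
Proof.
move=> Dx Dy; case: saD => _ _ /(_ y (ufun D y)).
by move=> [/(_ (conj Dy erefl)) + _]; apply.
Qed.

(** The spectral measure of [x] is the sum of those of [P x] and [Q x], as [P]
    commutes with the spectral projections. *)
Lemma reducing_form x : udom D x ->
  [/\ udom D (P x), udom D (Q x) & hdot (ufun D x) x =
      hdot (ufun D (P x)) (P x) + hdot (ufun D (Q x)) (Q x)].
Proof.
move=> Dx; have [E [[ET _ Em] PE]] := PD.
have [m [mE mdom mval]] := Em x.
have [m1 [m1E m1dom m1val]] := Em (P x).
have [m2 [m2E m2dom m2val]] := Em (Q x).
have [| | |q1 q2 mint] := @moment_split R m m1 m2.
- move=> S mS; rewrite mE// m1E// m2E// -EFinD; congr (_%:E).
  rewrite -raddfD/=; congr (complex.Re _).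
  have -> : hdot (E S (P x)) (P x) = hdot (P (E S x)) x.
    by rewrite -PE// -oproj_sym oproj_idem.
  have -> : hdot (E S (Q x)) (Q x) = hdot (Q (E S x)) x.
    have -> : E S (Q x) = Q (E S x) by rewrite !oproj_complE linearB/= PE.
    by rewrite -oproj_sym oproj_idem.
  by rewrite -hdotDl oproj_add_compl.
- by rewrite mE// ltry.
- exact/mdom.
have [DP DQ] : udom D (P x) /\ udom D (Q x) by split; [exact/m1dom|exact/m2dom].
split=> //; rewrite mval// m1val// m2val//.
by rewrite -rmorphD mint.
Qed.

Lemma ufun_at0 : ufun D 0 = 0.
Proof.
have [_ D0E] := uop_linear 1 udom_at0 udom_at0.
by apply: (addrI (ufun D 0)); move: D0E; rewrite !scale1r !addr0.
Qed.

Lemma uop_linearZ x c : udom D x ->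
  udom D (c *: x) /\ ufun D (c *: x) = c *: ufun D x.
Proof.
move=> Dx; have := uop_linear c Dx udom_at0.
by rewrite !addr0 => -[Dcx ->]; rewrite ufun_at0 addr0.
Qed.

(** Polarizing the additivity of the form at [c *: P x + Q y], with [c] the
    conjugate of [<D P x, Q y>], gives [2 |<D P x, Q y>|^2 = 0]. *)
Lemma reducing_ortho x y : udom D x -> udom D y ->
  hdot (ufun D (P x)) (Q y) = 0.
Proof.
move=> Dx Dy; set s := hdot _ _; pose c := Num.conj s.
have [DPx _ _] := reducing_form Dx; have [_ DQy _] := reducing_form Dy.
have [DcPx DcPxE] := uop_linearZ c DPx.
have [Dz DzE] := uop_linear c DPx DQy.
have [_ _] := reducing_form Dz.
have -> : P (c *: P x + Q y) = c *: P x.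
  by rewrite linearP/= oproj_idem oproj_compl0 addr0.
have -> : Q (c *: P x + Q y) = Q y.
  by rewrite linearP/= oproj_compl_idem compl_oproj0 scaler0 add0r.
have cancel (a b d e : R[i]) : a + b + (d + e) = a + e -> b + d = 0.
  move=> h; have -> : b + d = a + b + (d + e) - (a + e) by ring.
  by rewrite h subrr.
rewrite DzE DcPxE hdotDl !(hdotDr _ (c *: P x) (Q y)) => /cancel.
rewrite hdotZl -/s hdotZr (uop_sym DQy DPx) (hdotC (Q y)) -/s -/c.
rewrite /c conjCK [X in X + _]mulrC -normCK -mulr2n => /eqP.
by rewrite mulrn_eq0/= expf_eq0/= normr_eq0 => /eqP.
Qed.

(** [D P x] has no component in the range of [Q] and [D Q x] none in that of
    [P], since [<D P x, Q w> = 0] for all [w] in the dense domain. *)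
Lemma reducing x : udom D x -> udom D (P x) /\ ufun D (P x) = P (ufun D x).
Proof.
move=> Dx; have [DPx DQx _] := reducing_form Dx; split=> //.
have dD : dense (udom D) by case: saD.
have xE : ufun D x = ufun D (P x) + ufun D (Q x).
  by have := (uop_linear 1 DPx DQx).2; rewrite !scale1r oproj_add_compl.
have QDP : Q (ufun D (P x)) = 0.
  apply: (hdot_eq0_dense dD) => w Dw.
  by rewrite oproj_sym reducing_ortho.
have PDQ : P (ufun D (Q x)) = 0.
  apply: (hdot_eq0_dense dD) => w Dw; have [DPw _ _] := reducing_form Dw.
  by rewrite oproj_sym (uop_sym DQx DPw) hdotC reducing_ortho// conjC0.
by rewrite xE linearD/= PDQ addr0 -[LHS](oproj_add_compl P) QDP addr0.
Qed.

Lemma reducing_compl x : udom D x ->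
  udom D (Q x) /\ ufun D (Q x) = Q (ufun D x).
Proof.
move=> Dx; have [_ DQx _] := reducing_form Dx; split=> //.
have [DPx DPxE] := reducing Dx.
rewrite [RHS]oproj_complE -DPxE; apply/eqP; rewrite eq_sym subr_eq; apply/eqP.
have := (uop_linear 1 DPx DQx).2; rewrite !scale1r oproj_add_compl => ->.
exact: addrC.
Qed.

End reducing.

(** * Direct sums, compressions and their symbols *)

Section direct_sum.
Context {R : realType}.

Lemma nrm_hsum (V W : hilbertType R) (x : hsum V W) :
  nrm x ^+ 2 = nrm x.1 ^+ 2 + nrm x.2 ^+ 2.
Proof.
by apply: (@complexI R); rewrite rmorphD/= !rmorphXn/= !nrmE hsum_norm.
Qed.

Lemma nrm_hsum1 (V W : hilbertType R) (x : hsum V W) : nrm x.1 <= nrm x.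
Proof. by rewrite ler_nrm hsum_norm1. Qed.

Lemma nrm_hsum2 (V W : hilbertType R) (x : hsum V W) : nrm x.2 <= nrm x.
Proof. by rewrite ler_nrm hsum_norm2. Qed.

Lemma nrm_hsum_le (V W : hilbertType R) (x : hsum V W) :
  nrm x <= nrm x.1 + nrm x.2.
Proof. by rewrite -lecR rmorphD/= !nrmE hsum_norm_le. Qed.

Lemma nrm_rng (H : innerType R) (P : orthoproj H) (x : rng P) :
  nrm (rng_val x) = nrm x.
Proof. by rewrite /nrm rng_norm. Qed.

Lemma nrm_oproj_le (H : innerType R) (P : orthoproj H) (x : H) :
  nrm (P x) <= nrm x.
Proof. by rewrite ler_nrm oproj_norm_le. Qed.

Lemma nrm_prj_le (H : innerType R) (P : orthoproj H) (x : H) :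
  nrm (prj P x) <= nrm x.
Proof. by rewrite -nrm_rng nrm_oproj_le. Qed.

Lemma nrm_rng_add (H : hilbertType R) (P : orthoproj H)
    (u : hsum (rng P) (rng (oproj_compl P))) :
  nrm (rng_val u.1 + rng_val u.2) = nrm u.
Proof.
apply/eqP; rewrite -(@eqrXn2 _ 2%N) ?nrm_ge0//; apply/eqP.
apply: (@complexI R); rewrite -hdot_nrm nrm_hsum -!nrm_rng rmorphD/= -!hdot_nrm.
have E : hdot (rng_val u.1) (rng_val u.2) = 0.
  by rewrite -(rng_valK u.1) -(rng_valK u.2) oproj_ortho.
by rewrite hdotDl !hdotDr E [X in _ + (X + _)]hdotC E conjC0 addr0 add0r.
Qed.

End direct_sum.

Section rho.
Context {R : realType} {H : hilbertType R}.
Variables (cA A : set (H -> H)) (D : uop H) (P : orthoproj H).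
Hypothesis hT : toeplitz_type cA A D P.

Lemma calkinD (t k : rng P -> rng P) : compact_op k -> calkin (t + k) = calkin t.
Proof.
move=> ck; apply/seteqP; split=> s [bs cs]; split=> //.
  have -> : s - t = (s - (t + k)) + k by rewrite opprD addrA subrK.
  exact: compact_opD.
by rewrite opprD addrA; exact: compact_opB.
Qed.

(** Faithfulness of [a |-> T(a)] modulo compact operators makes the symbol
    unique. *)
Lemma rho_toep a (k : rng P -> rng P) : cA a -> compact_op k ->
  rho cA (toep P a + k) = a.
Proof.
move=> Aa ck; apply: xget_unique; first by split=> //; rewrite calkinD.
move=> b [Ab]; rewrite calkinD// => /(tt_faithful hT Ab Aa); exact.
Qed.

End rho.

Section toeplitz_operator.
Context {R : realType} {H : hilbertType R} (P : orthoproj H).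

Lemma toep_bounded a : bounded_op a -> bounded_op (toep P a).
Proof.
move=> [la [M aM]]; split.
  by move=> c x y; apply: val_inj; rewrite /= la linearP.
exists M => x; rewrite -!nrm_rng (le_trans _ (aM (rng_val x)))//.
by rewrite ler_nrm oproj_norm_le.
Qed.

Lemma toepD a b : toep P (a + b) = toep P a + toep P b.
Proof. by apply/funext => x; apply: val_inj; rewrite /= linearD. Qed.

Lemma toepZ c a : toep P (c *: a) = c *: toep P a.
Proof. by apply/funext => x; apply: val_inj; rewrite /= linearZ. Qed.

Lemma toep0 : toep P 0 = 0.
Proof. by apply/funext => x; apply: val_inj; rewrite /= linear0. Qed.

Lemma toep_id : toep P idfun = idfun.
Proof. by apply/funext => x; apply: val_inj; rewrite /= rng_valK. Qed.

Lemma toep_adjoint a b : is_adjoint a b -> is_adjoint (toep P a) (toep P b).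
Proof.
move=> ab x y; rewrite -[LHS]/(hdot (P (a (rng_val x))) (rng_val y)).
rewrite -[RHS]/(hdot (rng_val x) (P (b (rng_val y)))).
by rewrite oproj_sym rng_valK ab -oproj_sym rng_valK.
Qed.

End toeplitz_operator.

(** * Commutators with the matrix operator *)

Section dirac_commutator.
Context {R : realType} {H : hilbertType R}.
Variables (cA A : set (H -> H)) (D : uop H) (P : orthoproj H).
Hypothesis hT : toeplitz_type cA A D P.
Local Notation PH := (rng P).
Local Notation Q := (oproj_compl P).
Local Notation Dp := (Defs.restrict D P).

Let saD : self_adjoint D := st_self_adjoint (tt_triple hT).
Let PD : commutes_with P D := tt_commutes hT.

Variables (t : PH -> PH) (a : H -> H).
Hypotheses (lt : linear t) (la : linear a) (rhot : rho cA t = a).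

(** The identification of [PH + (I - P)H] with [H]; in terms of it the last two
    rows of the matrix operator combine into [D] itself. *)
Definition rng_sum (u : hsum (rng P) (rng Q)) : H := rng_val u.1 + rng_val u.2.

Lemma rng_sum_split (h : H) :
  rng_sum ((prj P h, prj Q h) : hsum (rng P) (rng Q)) = h.
Proof. exact: oproj_add_compl. Qed.

Lemma P_rng_sum u : P (rng_sum u) = rng_val u.1.
Proof.
by rewrite linearD/= rng_valK -(rng_valK u.2) oproj_compl0 addr0.
Qed.

Lemma Q_rng_sum u : Q (rng_sum u) = rng_val u.2.
Proof.
by rewrite [LHS]oproj_complE P_rng_sum /rng_sum [rng_val u.1 + _]addrC addrK.
Qed.

Lemma rng_sumB u u' : rng_sum (u - u') = rng_sum u - rng_sum u'.
Proof. by rewrite /rng_sum !rng_valB opprD addrACA. Qed.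

Lemma udom_Dab_rng_sum (al be : R) (v : Ksum P) : udom (Dab D P al be) v <->
  udom D (rng_val v.1) /\ udom D (rng_sum v.2).
Proof.
split=> [[D1 D2 D3]|[D1 D2]].
  split=> //; rewrite /rng_sum -[rng_val v.2.1]scale1r.
  by case: (uop_linear saD 1 D2 D3).
have [DP _] := reducing saD PD D2; have [DQ _] := reducing_compl saD PD D2.
by rewrite P_rng_sum in DP; rewrite Q_rng_sum in DQ.
Qed.

Lemma rng_sum_pi_rep (v : Ksum P) : rng_sum (pi_rep cA t v).2 = a (rng_sum v.2).
Proof. by rewrite /pi_rep rhot; exact: rng_sum_split. Qed.

(** The domain does not depend on [be], which makes the commutators for
    different [be] comparable vector by vector. *)
Lemma udom_commutator_Dab (al be : R) (v : Ksum P) :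
  udom (commutator (Dab D P al be) (pi_rep cA t)) v <->
  [/\ udom D (rng_val v.1), udom D (rng_val (t v.1)) &
      udom (commutator D a) (rng_sum v.2)].
Proof.
split=> [/udom_commutator[]|[D1 D2 /udom_commutator[D3 D4]]].
  move=> /udom_Dab_rng_sum H1 /udom_Dab_rng_sum H2.
  case: H1 => D1 D2; case: H2 => D3 D4.
  rewrite -/(pi_rep cA t v) rng_sum_pi_rep in D2.
  by split=> //; exact/udom_commutator.
by apply/udom_commutator; split; apply/udom_Dab_rng_sum; rewrite ?rng_sum_pi_rep.
Qed.

Lemma restrict_rng (x : PH) : udom D (rng_val x) ->
  rng_val (ufun Dp x) = ufun D (rng_val x).
Proof.
move=> Dx; rewrite /= -[in LHS](rng_valK x).
have [_ ->] := reducing saD PD Dx.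
by rewrite oproj_idem -(reducing saD PD Dx).2 rng_valK.
Qed.

Lemma rng_sum_Dab (be : R) (v : Ksum P) : udom (Dab D P 1 be) v ->
  rng_sum (ufun (Dab D P 1 be) v).2 =
  be%:C *: ufun D (rng_val v.1) + ufun D (rng_sum v.2).
Proof.
move=> /udom_Dab_rng_sum[D1 D2].
have [_ DP] := reducing saD PD D2; have [_ DQ] := reducing_compl saD PD D2.
rewrite /= invr1 !scale1r -(restrict_rng D1) {1}/rng_sum -addrA; congr (_ + _).
  by rewrite /= oproj_idem.
rewrite -[LHS]/(P (ufun D (rng_val v.2.1)) + Q (ufun D (rng_val v.2.2))).
by rewrite -(P_rng_sum v.2) -(Q_rng_sum v.2) DP DQ !oproj_idem oproj_add_compl.
Qed.

(** As [P] reduces [D], the last two rows of the matrix operator recombine into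
    [h |-> D h], so their commutator with [pi(t)] is [[D, a]] up to a multiple of
    [be]. *)
Lemma commutator_Dab (be : R) (v : Ksum P) :
  udom (commutator (Dab D P 1 be) (pi_rep cA t)) v ->
  let w := ufun (commutator (Dab D P 1 be) (pi_rep cA t)) v in
  w.1 = be%:C *: (ufun Dp (prj P (a (rng_sum v.2)))
                  - t (ufun Dp v.2.1)) /\
  rng_sum w.2 = be%:C *: (ufun D (rng_val (t v.1)) - a (ufun D (rng_val v.1)))
             + ufun (commutator D a) (rng_sum v.2).
Proof.
move=> /udom_commutator[Dp Dv] w; split.
  rewrite scalerBr -(linear_funZ lt) -[LHS]/(_ - _); congr (_ - _).
  by rewrite /pi_rep rhot.
rewrite -[w.2]/((ufun (Dab D P 1 be) (pi_rep cA t v)).2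
    - (pi_rep cA t (ufun (Dab D P 1 be) v)).2) rng_sumB.
rewrite rng_sum_pi_rep !rng_sum_Dab// rng_sum_pi_rep.
rewrite (linear_funD la (_ *: _)) (linear_funZ la).
by rewrite opprD addrACA scalerBr.
Qed.

Lemma udom_commutator_rng_sum (al be : R) (h : H) : udom (commutator D a) h ->
  udom (commutator (Dab D P al be) (pi_rep cA t))
    ((0, (prj P h, prj Q h)) : Ksum P).
Proof.
move=> Dh; apply/udom_commutator_Dab; rewrite (linear_fun0 lt) rng_sum_split/=.
have D0 : udom D 0 by case: saD => -[].
by [].
Qed.

(** Restrict to the vectors [(0, h)]. *)
Lemma L_A_le_L_T (be : R) : (L_A D a <= L_T cA D P 1 be t)%E.
Proof.
apply: unorm_le => h Dh h1; have Dv := udom_commutator_rng_sum 1 be Dh.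
have [_ w2] := commutator_Dab Dv; set v : Ksum P := (0, _) in Dv w2.
have v1 : nrm v <= 1.
  rewrite (le_trans (nrm_hsum_le v))// [nrm v.1]nrm0 add0r.
  by rewrite -[nrm v.2]nrm_rng_add -/(rng_sum v.2) rng_sum_split.
apply: le_trans (unorm_ge Dv v1).
have -> : ufun (commutator D a) h =
    rng_sum (ufun (commutator (Dab D P 1 be) (pi_rep cA t)) v).2.
  rewrite w2 -[v.2]/(_, _) -[v.1]/0 rng_sum_split (linear_fun0 lt).
  by rewrite (ufun_at0 saD) (linear_fun0 la) subr0 scaler0 add0r.
by rewrite lee_fin nrm_rng_add nrm_hsum2.
Qed.

Lemma L_T_at0 : L_T cA D P 1 0 t = L_A D a.
Proof.
apply/eqP; rewrite eq_le L_A_le_L_T andbT; apply: unorm_le => v Dv v1.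
have [w1 w2] := commutator_Dab Dv.
rewrite scale0r in w1; rewrite scale0r add0r in w2.
have /udom_commutator_Dab[_ _ Dh] := Dv.
apply: le_trans (unorm_ge Dh _); last first.
  by rewrite nrm_rng_add (le_trans _ v1)// nrm_hsum2.
rewrite -w2 lee_fin nrm_rng_add; apply: (le_trans (nrm_hsum_le _)).
by rewrite w1 nrm0 add0r.
Qed.

End dirac_commutator.

(** * The limit of the seminorms *)

Section perturbation.
Context {R : realType} {H : hilbertType R}.
Variables (cA A : set (H -> H)) (D : uop H) (P : orthoproj H).
Hypothesis hT : toeplitz_type cA A D P.
Local Notation PH := (rng P).
Local Notation Dp := (Defs.restrict D P).

Let saD : self_adjoint D := st_self_adjoint (tt_triple hT).
Let PD : commutes_with P D := tt_commutes hT.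

Lemma A_sub_cA a : A a -> cA a. Proof. exact: st_sub (tt_triple hT) a. Qed.

Lemma A_bounded a : A a -> bounded_op a.
Proof. by move=> Aa; have [h _ _ _ _] := st_star (tt_triple hT); exact: h. Qed.

(** The perturbation is [be] times a bounded operator. The bound [C] comes from
    the bounds [M1] of [[PD, a]] and [M2] of [k D_p], which control each of the
    two rows of the commutator. *)
Lemma L_T_upper a (k : PH -> PH) : A a -> is_adjoint a a ->
  smooth_compact D k -> is_adjoint k k ->
  exists2 C : R, 0 <= C & forall be : R, 0 <= be ->
    (L_T cA D P 1 be (toep P a + k)%R <= L_A D a + (be * C)%:E)%E.
Proof.
move=> Aa aa [ck _ kD] kk.
have [lk la] := ((compact_op_bounded ck).1, (A_bounded Aa).1).
have [_ [M1 M10 HM1]] := densely_boundedP (tt_bounded hT Aa).1.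
have [_ [M2 M20 HM2]] := densely_boundedP kD.
have [dDa _] := st_bounded (tt_triple hT) Aa.
have rhot : rho cA (toep P a + k) = a.
  by apply: (rho_toep hT) => //; exact: A_sub_cA.
have lt : linear (toep P a + k).
  exact: (bounded_opD (toep_bounded P (A_bounded Aa)) (compact_op_bounded ck)).1.
set t := toep P a + k in rhot lt *.
exists (2 * (M1 + M2)) => [|be be0]; first by rewrite mulr_ge0// addr_ge0.
apply: unorm_le => v Dv v1.
have [w1 w2] := commutator_Dab hT lt la rhot Dv.
have /(udom_commutator_Dab hT rhot)[Dx Dtx Dh] := Dv.
have /udom_commutator[Dah Dg] := Dh.
move: w1 w2; set w := ufun _ v; set h := rng_sum v.2 in Dh Dah Dg *.
set x := v.1 in Dx Dtx * => w1 w2.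
have [DPh DPhE] := reducing saD PD Dg.
have nh : nrm h <= nrm v by rewrite nrm_rng_add nrm_hsum2.
have nx : nrm x <= nrm v by exact: nrm_hsum1.
have ny : nrm v.2.1 <= nrm v by rewrite (le_trans (nrm_hsum1 v.2))// nrm_hsum2.
(* This difference is P [PD, a] h - k D y, where y = P h. *)
have b1 : nrm (ufun Dp (prj P (a h)) - t (ufun Dp v.2.1)) <= M1 + M2.
  have Dy : udom D (rng_val v.2.1) by rewrite -(P_rng_sum v.2).
  have -> : ufun Dp (prj P (a h)) - t (ufun Dp v.2.1) =
      prj P (ufun (commutator (compressed D P) a) h) - k (ufun Dp v.2.1).
    apply: val_inj.
    rewrite -[LHS]/(P (ufun D (P (a h))) -
                    (P (a (P (ufun D (rng_val v.2.1)))) +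
                     rng_val (k (ufun Dp v.2.1)))).
    rewrite -[RHS]/(P (P (ufun D (a h)) - a (P (ufun D h))) -
                    rng_val (k (ufun Dp v.2.1))).
    rewrite opprD addrA linearB/=; congr (_ - _ - _).
      by rewrite (reducing saD PD Dah).2.
    by rewrite -(P_rng_sum v.2) DPhE !oproj_idem.
  apply: (le_trans (ler_nrmB _ _)); apply: lerD.
    apply: (le_trans (nrm_prj_le _ _)).
    apply: (le_trans (HM1 h _)); first exact/udom_commutator_compressed.
    by rewrite ler_piMr// (le_trans nh).
  apply: (le_trans (HM2 v.2.1 _)); first by split.
  by rewrite ler_piMr// (le_trans ny).
(* The vector a x need not be in the domain of D. Tested against g in the
   domain of [D, a], the difference becomes <x, k D P g> - <x, [PD, a] g>. *)
have b2 : nrm (ufun D (rng_val (t x)) - a (ufun D (rng_val x))) <= M1 + M2.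
  apply: (nrm_le_dense dDa); first exact: addr_ge0.
  move=> g Dg'; have /udom_commutator[Dag Dgg] := Dg'.
  have [DPg DPgE] := reducing saD PD Dgg.
  have -> : hdot (ufun D (rng_val (t x)) - a (ufun D (rng_val x))) g =
      hdot x (k (ufun Dp (prj P g)))
      - hdot (rng_val x) (ufun (commutator (compressed D P) a) g).
    rewrite hdotBl (uop_sym saD Dtx Dgg) aa (uop_sym saD Dx Dag) -kk.
    rewrite -[rng_val (t x)]/(P (a (rng_val x)) + rng_val (k x)) hdotDl.
    rewrite -[hdot (k x) _]/(hdot (rng_val (k x)) (P (ufun D (P g)))).
    rewrite DPgE oproj_idem oproj_sym aa -(rng_valK (k x)) oproj_sym.
    rewrite -[ufun (commutator _ _) _]/(P (ufun D (a g)) - a (P (ufun D g))) hdotBr.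
    rewrite -[hdot (rng_val x) (P _)]oproj_sym !rng_valK; ring.
  apply: (le_trans (ler_nrmB _ _)); rewrite mulrDl addrC; apply: lerD.
    apply: (le_trans (nrm_hdot_le _ _)).
    have := HM1 g; rewrite udom_commutator_compressed => /(_ (conj Dag Dgg)) H1.
    apply: le_trans H1; rewrite ler_piMl ?nrm_ge0// nrm_rng.
    exact: le_trans v1.
  apply: (le_trans (nrm_hdot_le _ _)).
  have H2 : nrm (k (ufun Dp (prj P g))) <= M2 * nrm g.
    apply: (le_trans (HM2 (prj P g) _)); first by split.
    rewrite ler_wpM2l// -nrm_rng; first by rewrite ler_nrm oproj_norm_le.
  apply: le_trans H2; rewrite ler_piMl ?nrm_ge0//.
  exact: le_trans v1.
have b3 := unorm_ge Dh (le_trans nh v1).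
apply: (@le_trans _ _
  (nrm (ufun (commutator D a) h) + be * (2 * (M1 + M2)))%:E); last first.
  by rewrite EFinD leeD2r.
rewrite lee_fin (le_trans (nrm_hsum_le _))//.
rewrite w1 -[nrm w.2]nrm_rng_add -/(rng_sum _) w2.
rewrite nrmZ nrm_real ger0_norm//.
have := ler_nrmD (be%:C *: (ufun D (rng_val (t x)) - a (ufun D (rng_val x))))
  (ufun (commutator D a) h).
rewrite nrmZ nrm_real ger0_norm//.
have := ler_wpM2l be0 b1; have := ler_wpM2l be0 b2; lra.
Qed.

End perturbation.

Section limit.
Context {R : realType} {H : hilbertType R}.
Variables (cA A : set (H -> H)) (D : uop H) (P : orthoproj H).
Hypothesis hT : toeplitz_type cA A D P.
Local Notation PH := (rng P).

Let saD : self_adjoint D := st_self_adjoint (tt_triple hT).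

Lemma udom_shift c a x : udom D x ->
  (udom D (a x + c *: x) <-> udom D (a x)).
Proof.
move=> Dx; rewrite addrC; split; last first.
  by move=> Dax; case: (uop_linear saD c Dx Dax).
move=> Dax; have := (uop_linear saD (- c) Dx Dax).1.
by rewrite addrA scaleNr addNr add0r.
Qed.

Lemma L_A_shift_le c a : (L_A D (a + c *: idfun)%R <= L_A D a)%E.
Proof.
apply: unorm_le => x /udom_commutator[Dax Dx] x1.
have {}Dax : udom D (a x) by apply/(udom_shift c a Dx).
have -> : ufun (commutator D (a + c *: idfun)) x = ufun (commutator D a) x.
  rewrite -[LHS]/(ufun D (a x + c *: x) - (a (ufun D x) + c *: ufun D x)).
  rewrite [a x + _]addrC (uop_linear saD c Dx Dax).2.
  by rewrite [a (ufun D x) + _]addrC opprD addrACA subrr add0r.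
by apply: unorm_ge => //; exact/udom_commutator.
Qed.

(** Scalars commute with [D]; this absorbs the real multiple of the identity
    in an element of [A_C] into [a]. *)
Lemma L_A_shift c a : L_A D (a + c *: idfun) = L_A D a.
Proof.
apply/eqP; rewrite eq_le L_A_shift_le/=.
rewrite -[X in (L_A D X <= _)%E](addrK (c *: (idfun : H -> H))) -scaleNr.
exact: L_A_shift_le.
Qed.

Lemma A_shift c a : A a -> A (a + c *: idfun).
Proof.
move=> Aa; rewrite addrC; apply: star_lin => //.
  exact: st_star (tt_triple hT).
exact: st_unit (tt_triple hT).
Qed.

Lemma L_T_limit a (k : PH -> PH) : sa_A A a -> sa_C D P k ->
  (L_T cA D P 1 be (toep P a + k) @[be --> (0 : R)^'+]
     --> L_T cA D P 1 0 (toep P a + k)) /\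
  L_T cA D P 1 0 (toep P a + k) = L_A D a.
Proof.
move=> [Aa aa] [k0 [l [sk kk ->]]]; pose a' := a + l%:C *: (idfun : H -> H).
have la := (A_bounded hT Aa).1.
have Aa' : A a' by exact: A_shift.
have aa' : is_adjoint a' a'.
  move=> x y; rewrite -[LHS]/(hdot (a x + l%:C *: x) y).
  rewrite -[RHS]/(hdot x (a y + l%:C *: y)) hdotDl hdotDr aa hdotZl hdotZr.
  by congr (_ + _ * _); rewrite conj_Creal// complex_real.
have -> : toep P a + (k0 + l%:C *: (idfun : PH -> PH)) = toep P a' + k0.
  by rewrite toepD toepZ toep_id -addrA [k0 + _]addrC.
have [ck _ _] := sk.
have rhot : rho cA (toep P a' + k0) = a'.
  by apply: (rho_toep hT) => //; exact: (A_sub_cA hT).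
have ba' := A_bounded hT Aa'.
have lt : linear (toep P a' + k0).
  exact: (bounded_opD (toep_bounded P ba') (compact_op_bounded ck)).1.
have L0 := L_T_at0 hT lt ba'.1 rhot.
have LaE : L_A D a' = L_A D a by exact: L_A_shift.
split; last by rewrite L0 LaE.
have [C C0 HC] := L_T_upper hT Aa' aa' sk kk.
rewrite L0; apply: (@squeeze_cvge _ _ _ _ (fun=> L_A D a') _
    (fun be => (L_A D a' + (be * C)%:E)%E)).
- near=> be; rewrite (L_A_le_L_T hT lt ba'.1 rhot)/= HC//.
- exact: cvg_cst.
- rewrite -[X in _ --> X]adde0; apply: cvgeD.
  + by rewrite fin_num_adde_defl.
  + exact: cvg_cst.
  + apply: cvg_EFin; first by near=> x.
    rewrite -[X in _ --> X](mul0r C); apply: cvgMl.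
    exact: cvg_at_right_filter.
Unshelve. all: by end_near.
Qed.

End limit.

(** * Smooth elements of the Toeplitz algebra *)

Section toeplitz_states.
Context {R : realType} {H : hilbertType R}.
Variables (cA A : set (H -> H)) (D : uop H) (P : orthoproj H).
Hypotheses (hcA : unital_cstar_algebra cA) (hT : toeplitz_type cA A D P).
Local Notation PH := (rng P).
Local Notation Dp := (Defs.restrict D P).

Let saD : self_adjoint D := st_self_adjoint (tt_triple hT).

Lemma A_algebra : star_algebra A. Proof. exact: st_star (tt_triple hT). Qed.

Lemma cA_algebra : star_algebra cA. Proof. by case: hcA => -[]. Qed.

Lemma cA_Z c a : cA a -> cA (c *: a).
Proof.
move=> Aa; rewrite -[c *: a]addr0; apply: (star_lin cA_algebra) => //.
exact: (star0 cA_algebra).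
Qed.

Lemma cA_bounded a : cA a -> bounded_op a.
Proof. by move=> Aa; have [h _ _ _ _] := cA_algebra; exact: h. Qed.

Lemma dense_Dp : dense (udom Dp).
Proof.
have [/denseP dP _] := tt_dense hT (st_unit (tt_triple hT)).
apply/denseP => x e e0; have [y Dy xy] := dP x e e0; exists y => //.
by have [] := (udom_commutator _ _ _).1 Dy.
Qed.

(** [D_p (<., v> u) = <., v> D u] and [(<., v> u) D_p] extends
    to [<., D v> u]. *)
Lemma rank_one_smooth (u v : PH) : udom Dp u -> udom Dp v ->
  smooth_compact D (rank_one u v).
Proof.
move=> Du Dv; split; first exact: rank_one_compact.
- have Dcu c : udom D (rng_val (c *: u)) /\
      ufun D (rng_val (c *: u)) = c *: ufun D (rng_val u).
    exact: (uop_linearZ saD c Du).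
  split.
    apply/denseP => x e e0; exists x; last by rewrite subrr nrm0.
    by split=> //; exact: (Dcu _).1.
  exists (nrm v * nrm (ufun D (rng_val u))) => x _.
  rewrite -[ufun _ x]/(prj P (ufun D (rng_val (rank_one u v x)))) (Dcu _).2.
  apply: (le_trans (nrm_prj_le _ _)).
  by rewrite nrmZ mulrAC ler_wpM2r ?nrm_ge0// mulrC nrm_hdot_le.
- split.
    have /denseP dP := dense_Dp; apply/denseP => x e e0.
    by have [y Dy xy] := dP x e e0; exists y.
  exists (nrm (ufun D (rng_val v)) * nrm u) => x [Dx _].
  rewrite -[ufun _ x]/(hdot (P (ufun D (rng_val x))) (rng_val v) *: u) nrmZ.
  rewrite oproj_sym rng_valK (uop_sym saD Dx Dv) mulrAC ler_wpM2r ?nrm_ge0//.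
  by rewrite (le_trans (nrm_hdot_le _ _))// mulrC nrm_rng.
Qed.

Lemma toep_in_algebra a (k : PH -> PH) : cA a -> compact_op k ->
  toeplitz_algebra cA P (toep P a + k).
Proof.
move=> Aa ck S [[sS _] GS]; rewrite -[toep P a]scale1r.
by apply: (star_lin sS); apply: GS; [left; exists a|right].
Qed.

Lemma rank_one_adjoint (c : R) (u : PH) :
  is_adjoint (c%:C *: rank_one u u) (c%:C *: rank_one u u).
Proof.
move=> x y; rewrite -[LHS]/(hdot (c%:C *: (hdot x u *: u)) y).
rewrite -[RHS]/(hdot x (c%:C *: (hdot y u *: u))) !hdotZl !hdotZr.
by rewrite conj_Creal ?complex_real// -hdotC mulrCA [hdot x u * _]mulrC mulrA.
Qed.

Lemma rank_one_sa_T (c : R) (u : PH) : udom Dp u ->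
  sa_T A D P (c%:C *: rank_one u u).
Proof.
move=> Du; split; last exact: rank_one_adjoint.
exists 0, (c%:C *: rank_one u u); split; first exact: (star0 A_algebra).
  have -> : c%:C *: rank_one u u = rank_one (c%:C *: u) u.
    apply/funext => x; rewrite -[LHS]/(c%:C *: (hdot x u *: u)).
    by rewrite scalerA mulrC -scalerA.
  by apply: rank_one_smooth => //; case: (uop_linearZ saD c%:C Du).
by rewrite toep0 add0r.
Qed.

Lemma L_T_compact (k : PH -> PH) : compact_op k -> (L_T cA D P 1 0 k <= 0)%E.
Proof.
move=> ck; have rk : rho cA k = 0.
  rewrite -[k]add0r -(toep0 P).
  by apply: (rho_toep hT) => //; exact: (star0 cA_algebra).
rewrite (L_T_at0 hT (compact_op_bounded ck).1 _ rk); last exact: bounded_op0.1.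
apply: unorm_le => x _ _; rewrite lee_fin.
by rewrite -[ufun _ x]/(ufun D 0 - 0) (ufun_at0 saD) subr0 nrm0.
Qed.

(** With [b = a^*], the equation [t = t^*] reads [T(a) + k = T(b) + k^*]. As
    [k^*] is compact, [T(a)] and [T(b)] agree modulo compact operators. *)
Lemma symbol_selfadjoint a (k : PH -> PH) : A a -> compact_op k ->
  is_adjoint (toep P a + k) (toep P a + k) -> is_adjoint a a.
Proof.
move=> Aa ck tt; have [b Ab ab] := star_adj A_algebra Aa.
pose k' : PH -> PH := toep P a + k - toep P b.
have bb := toep_bounded P (A_bounded hT Ab).
have ba := toep_bounded P (A_bounded hT Aa).
have lk' : linear k' := (bounded_opB (bounded_opD ba (compact_op_bounded ck)) bb).1.
have kk' : is_adjoint k k'.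
  move=> x y; have := tt x y.
  rewrite -[hdot ((toep P a + k) x) y]/(hdot (toep P a x + k x) y) hdotDl.
  rewrite (toep_adjoint (P := P) ab) => tE.
  rewrite -[RHS]/(hdot x ((toep P a + k) y - toep P b y)) hdotBr -tE.
  by rewrite addrAC subrr add0r.
have ck' := adjoint_compact ck kk' lk'.
have ab' : a = b.
  apply: (tt_faithful hT); [exact: (A_sub_cA hT)|exact: (A_sub_cA hT)|].
  rewrite -(calkinD (toep P a) ck) -(calkinD (toep P b) ck').
  by congr calkin; rewrite /k' [RHS]addrC subrK.
by rewrite {2}ab'.
Qed.

End toeplitz_states.

(** * Distances of states *)

Section toeplitz_distance.
Context {R : realType} {H : hilbertType R}.
Variables (cA A : set (H -> H)) (D : uop H) (P : orthoproj H).
Hypotheses (hcA : unital_cstar_algebra cA) (hT : toeplitz_type cA A D P).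
Local Notation PH := (rng P).
Local Notation Dp := (Defs.restrict D P).

Variables (phi psi f g : functional PH) (mu nu : functional H).
Hypotheses (dphi : decomposition cA P phi f mu)
  (dpsi : decomposition cA P psi g nu).

Lemma fnorm_decomposition (phi' f' : functional PH) (mu' : functional H) :
  decomposition cA P phi' f' mu' ->
  (fnorm compact_op f' <= 1)%E /\
  exists2 r : R, 0 <= r & fnorm cA mu' = r%:E.
Proof.
move=> [_ _ fmu _].
have f0 : (0 <= fnorm compact_op f')%E by apply: fnorm_ge0; exact: compact_op0.
have m0 : (0 <= fnorm cA mu')%E.
  by apply: fnorm_ge0; exact: star0 (cA_algebra hcA).
split; first by rewrite -fmu leeDl.
have m1 : (fnorm cA mu' <= 1)%E by rewrite -fmu leeDr.
have mfin : fnorm cA mu' \is a fin_num.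
  by rewrite ge0_fin_numE// (le_lt_trans m1)// ltry.
exists (fine (fnorm cA mu')); first by rewrite fine_ge0.
by rewrite fineK.
Qed.

(** The domain of [D_p] is dense, so agreement on these operators passes to all
    rank one operators by continuity, and from there to all bounded operators by
    ultraweak continuity. *)
Lemma normal_extension_eq F G : normal_extension f F -> normal_extension g G ->
  (forall u : PH, udom Dp u -> f (rank_one u u) = g (rank_one u u)) ->
  eq_on bounded_op F G.
Proof.
move=> [lF Ff cF] [lG Gg cG] fg.
have [f1 _] := fnorm_decomposition dphi; have [g1 _] := fnorm_decomposition dpsi.
have [lf _] := dec_f dphi; have [lg _] := dec_f dpsi.
apply: ultraweak_eq_rank_one => // u v.
rewrite Ff ?Gg; try exact: rank_one_compact.
exact: (rank_one_diag_eq (dense_Dp hT) lf lg f1 g1 fg).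
Qed.

Lemma dist_T_eq0 : eq_on (toeplitz_algebra cA P) phi psi ->
  dist_T cA A D P 1 0 phi psi = 0%E.
Proof.
move=> phipsi; apply/eqP; rewrite eq_le; apply/andP; split.
  apply: ge_ereal_sup => _ [t [[[a [k [Aa [ck _ _] ->]]] _] _] <-].
  rewrite phipsi ?subrr ?nrm0//; apply: toep_in_algebra => //.
  exact: (A_sub_cA hT).
have D0 : udom Dp 0 by have := udom_at0 (st_self_adjoint (tt_triple hT)).
have s0 := rank_one_sa_T hT 0 D0.
pose t : PH -> PH := 0%:C *: rank_one 0 0.
apply: le_ereal_sup_tmp; exists (nrm (phi t - psi t))%:E.
  exists t => //; split=> //.
  apply: (le_trans (L_T_compact hcA hT _)); last by rewrite lee_fin.
  by apply: compact_opZ; exact: rank_one_compact.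
by rewrite lee_fin nrm_ge0.
Qed.

Lemma decomposition_compact (phi' f' : functional PH) (mu' : functional H) k :
  decomposition cA P phi' f' mu' -> compact_op k -> phi' k = f' k.
Proof.
move=> [_ [lmu _] _ [F [[_ Ff _] phiE]]] ck.
have kE : k = toep P 0 + k by rewrite toep0 add0r.
have cA0 := star0 (cA_algebra hcA).
rewrite phiE; last by rewrite kE; exact: toep_in_algebra.
rewrite Ff// [in rho _ _]kE (rho_toep hT)// (linear_on0 cA0 lmu).
by rewrite addr0.
Qed.

(** A smooth [<., u> u] separating [f] from [g] can be scaled freely, as
    [L_{1,0}] vanishes on it. *)
Lemma dist_T_infty : ~ eq_on compact_op f g ->
  dist_T cA A D P 1 0 phi psi = +oo%E.
Proof.
move=> fNg.
have [u Du fgu] : exists2 u : PH, udom Dp u & f (rank_one u u) <> g (rank_one u u).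
  apply: contra_notP fNg => noU.
  have [F [nF _]] := dec_eq dphi; have [G [nG _]] := dec_eq dpsi.
  have FG : eq_on bounded_op F G.
    apply: (normal_extension_eq nF nG) => u Du; apply: contra_notP noU => ?.
    by exists u.
  move=> k ck; have [_ Ff _] := nF; have [_ Gg _] := nG.
  by rewrite -Ff// -Gg// FG//; exact: compact_op_bounded.
have d0 : 0 < nrm (f (rank_one u u) - g (rank_one u u)).
  by rewrite lt_neqAle eq_sym nrm_eq0 nrm_ge0 andbT subr_eq0; apply/eqP.
apply/eqyP => B B0; apply: ereal_sup_ubound.
set d := nrm _ in d0; pose t := (B / d)%:C *: rank_one u u.
have ct : compact_op t by apply: compact_opZ; exact: rank_one_compact.
exists t; first split.
- exact: (rank_one_sa_T hT).
- by apply: (le_trans (L_T_compact hcA hT ct)); rewrite lee_fin.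
have [lf _] := dec_f dphi; have [lg _] := dec_f dpsi.
rewrite (decomposition_compact dphi ct) (decomposition_compact dpsi ct).
have [cu c0] := (rank_one_compact u u, compact_op0 (V := PH)).
rewrite /t -[_ *: rank_one u u]addr0 lf// lg//.
rewrite (linear_on0 compact_op0 lf) (linear_on0 compact_op0 lg) !addr0.
rewrite -mulrBr nrmM nrm_real ger0_norm ?divr_ge0 ?ltW// -/d.
by rewrite divfK// gt_eqF.
Qed.

(** Once [f = g], the difference [phi - psi] factors through [rho] as
    [mu - nu], and [rho] carries one unit ball of seminorms onto the other. *)
Lemma dist_T_scale_A : eq_on compact_op f g -> ~ eq_on cA mu nu ->
  let m := fnorm cA mu in
  dist_T cA A D P 1 0 phi psi =
  (m * dist_A A D (fun a => mu a / (fine m)%:C)%R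
                  (fun a => nu a / (fine m)%:C)%R)%E.
Proof.
move=> fg munu m.
have [f1 [r r0 mr]] := fnorm_decomposition dphi.
have [g1 [r' r'0 mr']] := fnorm_decomposition dpsi.
have [lmu _] := dec_mu dphi; have [lnu _] := dec_mu dpsi.
have cA0 := star0 (cA_algebra hcA).
have rr' : r' = r.
  have := dec_norm dpsi; rewrite -(dec_norm dphi) -(fnorm_eq_on fg) mr mr'.
  have : fnorm compact_op f \is a fin_num.
    rewrite ge0_fin_numE; first by rewrite (le_lt_trans f1)// ltry.
    by apply: fnorm_ge0; exact: compact_op0.
  by move=> /fineK <-; rewrite -!EFinD => -[/addrI].
(* If |mu| = 0 then |nu| = 0 as well, so both vanish. *)
have r_gt0 : 0 < r.
  rewrite lt_neqAle r0 andbT; apply/eqP => r_eq0; apply: munu => a Aa.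
  have [M M0 HM] := bounded_opP (cA_bounded hcA Aa).
  have z (mu' : functional H) :
      linear_on cA mu' -> fnorm cA mu' = r%:E -> mu' a = 0.
    move=> l' m'; apply/eqP; rewrite -nrm_eq0 eq_le nrm_ge0 andbT.
    have := fnorm_bound l' cA0 (fun c b => @cA_Z _ _ _ hcA c b) _ Aa M0 HM.
    by rewrite m' => /(_ _ (lexx _)); rewrite -r_eq0 mul0r.
  by rewrite (z mu)// (z nu)// mr' rr'.
have phiE a (k : PH -> PH) : A a -> compact_op k ->
    phi (toep P a + k) - psi (toep P a + k) = mu a - nu a.
  move=> Aa ck; have cAa := A_sub_cA hT Aa.
  have [F [nF phiE]] := dec_eq dphi; have [G [nG psiE]] := dec_eq dpsi.
  have tT := toep_in_algebra (P := P) cAa ck.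
  rewrite phiE// psiE// (rho_toep hT)//.
  have -> : F (toep P a + k) = G (toep P a + k).
    apply: (normal_extension_eq nF nG) => [u _|].
      by apply: fg; exact: rank_one_compact.
    apply: bounded_opD; last exact: compact_op_bounded.
    exact: (toep_bounded P (A_bounded hT Aa)).
  by rewrite opprD addrACA subrr add0r.
have scale a : nrm (mu a - nu a) = r * nrm (mu a / r%:C - nu a / r%:C).
  rewrite -mulrBl nrmM nrmV nrm_real ger0_norm// mulrCA divff ?mulr1//.
  by rewrite gt_eqF.
rewrite /m mr /=; apply/eqP; rewrite eq_le; apply/andP; split.
  apply: ge_ereal_sup => _ [t [[[a [k [Aa [ck _ _] ->]]] tt] Lt] <-].
  rewrite phiE// scale EFinM lee_pmul2l//; apply: ereal_sup_ubound; exists a => //.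
  split; first by split=> //; exact: (symbol_selfadjoint hT Aa ck tt).
  have lt : linear (toep P a + k).
    exact: (bounded_opD (toep_bounded P (A_bounded hT Aa)) (compact_op_bounded ck)).1.
  rewrite -(L_T_at0 hT lt (A_bounded hT Aa).1)//.
  by apply: (rho_toep hT) => //; exact: (A_sub_cA hT).
rewrite -lee_pdivlMl//; apply: ge_ereal_sup => _ [a [[Aa aa] La] <-].
rewrite lee_pdivlMl// -EFinM -scale -(phiE a (rank_one 0 0) Aa); last first.
  exact: rank_one_compact.
have sk : smooth_compact D (rank_one (0 : PH) 0).
  have D0 : udom Dp 0 by have := udom_at0 (st_self_adjoint (tt_triple hT)).
  exact: (rank_one_smooth hT).
have [ck _ _] := sk.
have k0 : rank_one (0 : PH) 0 = 0.
  by apply/funext => x; rewrite /rank_one scaler0.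
apply: ereal_sup_ubound; exists (toep P a + rank_one 0 0) => //; split.
  split; first by exists a, (rank_one 0 0).
  by rewrite k0 addr0; exact: toep_adjoint.
have lt : linear (toep P a + rank_one (0 : PH) 0).
  exact: (bounded_opD (toep_bounded P (A_bounded hT Aa)) (compact_op_bounded ck)).1.
rewrite (L_T_at0 hT lt (A_bounded hT Aa).1)//.
by apply: (rho_toep hT) => //; exact: (A_sub_cA hT).
Qed.

End toeplitz_distance.

Theorem theorem4p3 (R : realType) (H : hilbertType R)
    (cA A : set (H -> H)) (D : uop H) (P : orthoproj H)
    (hcA : unital_cstar_algebra cA)
    (hT : toeplitz_type cA A D P)
    (hL : lip_norm_A cA A D) :
  (forall (a : H -> H) (k : rng P -> rng P),
     sa_A A a -> sa_C D P k ->
     (L_T cA D P 1 be (toep P a + k) @[be --> (0 : R)^'+]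
        --> L_T cA D P 1 0 (toep P a + k)) /\
     L_T cA D P 1 0 (toep P a + k) = L_A D a) /\
  (forall (phi psi f g : functional (rng P)) (mu nu : functional H),
     state (toeplitz_algebra cA P) phi -> state (toeplitz_algebra cA P) psi ->
     decomposition cA P phi f mu -> decomposition cA P psi g nu ->
     let d := dist_T cA A D P 1 0 phi psi in
     let m := fnorm cA mu in
     [/\ eq_on (toeplitz_algebra cA P) phi psi -> d = 0%E,
         ~ eq_on compact_op f g -> d = +oo%E &
         eq_on compact_op f g -> ~ eq_on cA mu nu ->
           d = (m * dist_A A D (fun a => mu a / (fine m)%:C)%R
                               (fun a => nu a / (fine m)%:C)%R)%E]).
Proof.
split=> [a k Aa Ck|phi psi f g mu nu _ _ dphi dpsi d m]; first exact: (L_T_limit hT).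
split; first exact: (dist_T_eq0 hcA hT).
  exact: (dist_T_infty hcA hT dphi dpsi).
exact: (dist_T_scale_A hcA hT dphi dpsi).
Qed.
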